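(* Let $k\ge 4$, $2\le m\le\infty$, $q:=\lceil k/m\rceil$ (with the convention $\lceil k/\infty\rceil:=1$), $n\ge k+q$, and let $\mathcal{A}\subseteq\binom{[n]_m}{k}$. If $\mathcal{A}$ is non-trivial intersecting, then $|\mathcal{A}|\le|\mathcal{H}^m_{n,k}|$. Moreover, if one of the following two conditions holds: (A) $n>k+q$; (B) $n=k+q$ and $\min\{k,m\}\nmid k$; then $|\mathcal{A}|=|\mathcal{H}^m_{n,k}|$ if and only if $\mathcal{A}\cong\mathcal{H}^m_{n,k}$.
   Context: For $n\in\mathbb{N}^+$ and $m\in\mathbb{N}^+\cup\{\infty\}$, $[n]_m$ denotes the multiset containing exactly $m$ copies of each symbol $i\in\{1,\dots,n\}$. A sub(multi)set of $[n]_m$ is $A=\{\mu_1\cdot 1,\dots,\mu_n\cdot n\}$ with integers $0\le\mu_i\le m$ (no upper bound if $m=\infty$); its cardinality is $|A|=\sum_i\mu_i$, and $i\in A$ means $\mu_i\ge1$. The intersection of $A$ and $A'=\{\mu'_1\cdot1,\dots,\mu'_n\cdot n\}$ is $\{\min\{\mu_1,\mu'_1\}\cdot 1,\dots,\min\{\mu_n,\mu'_n\}\cdot n\}$. $\binom{[n]_m}{k}$ is the family of all subsets of $[n]_m$ of cardinality $k$. A family $\mathcal{A}$ is intersecting if $A_1\cap A_2\neq\emptyset$ for all $A_1,A_2\in\mathcal{A}$; it is non-trivial intersecting if additionally $\bigcap_{A\in\mathcal{A}}A=\emptyset$ (with the convention that the total intersection of the empty family is nonempty). For a permutation $\sigma$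 of $\{1,\dots,n\}$, $\sigma(A)=\{\mu_1\cdot\sigma(1),\dots,\mu_n\cdot\sigma(n)\}$; families $\mathcal{A}',\mathcal{A}$ are isomorphic, $\mathcal{A}'\cong\mathcal{A}$, if $\mathcal{A}'=\{\sigma(A):A\in\mathcal{A}\}$ for some permutation $\sigma$. Let $H:=\{n-k+1,\dots,n\}$ (each element with multiplicity one). The EKR-family is $\mathcal{E}^m_{n,k}:=\{A\in\binom{[n]_m}{k}:1\in A\}$ and the HM-family is $\mathcal{H}^m_{n,k}:=\{A\in\mathcal{E}^m_{n,k}:A\cap H\neq\emptyset\}\cup\{H\}$. *)

(* Defs.v *)
From mathcomp Require Import all_boot all_fingroup.
From mathcomp Require Import finmap multiset.

Set Implicit Arguments.
Unset Strict Implicit.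
Unset Printing Implicit Defensive.

Local Open Scope fset_scope.
Local Open Scope mset_scope.
Local Open Scope nat_scope.

(* An element of N^+ \cup {oo} is an [option nat], with [None] for oo; the
   positivity is left to the hypotheses of the statements. *)
Definition le_inf (a : nat) (m : option nat) : bool :=
  if m is Some b then a <= b else true.

Definition min_inf (k : nat) (m : option nat) : nat :=
  if m is Some b then minn k b else k.

(* ceil(k / m), with ceil(k / oo) = 1 *)
Definition ceil_div (k : nat) (m : option nat) : nat :=
  if m is Some b then (k + b - 1) %/ b else 1.

Lemma ceil_div_le (k b c : nat) :
  0 < b -> (ceil_div k (Some b) <= c) = (k <= c * b).
Proof.
case: b => // b _; rewrite /= addnS subn1 -ltnS ltn_divLR // mulSn.
by rewrite addSn ltnS addnC leq_add2l.
Qed.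

(* The symbols 1, ..., n are represented by the ordinals 0, ..., n-1. *)

Definition card_mset n (A : {mset 'I_n}) : nat := \sum_(i < n) A i.

(* The multisets of cardinality k are enumerated, with repetitions that [fset]
   discards, by the words of length k; see [in_ksubsets]. *)
Definition ksubsets (m : option nat) (n k : nat) : {fset {mset 'I_n}} :=
  [fset A : {mset 'I_n} in [fset seq_mset (tval t) | t in {: k.-tuple 'I_n}]
   | [forall i : 'I_n, le_inf (A i) m]].

Lemma card_msetE n (A : {mset 'I_n}) : card_mset A = size A.
Proof.
rewrite /card_mset -{1}(seq_mset_id A).
transitivity (\sum_(i < n) count_mem i A).
  by apply: eq_bigr => i _; rewrite mset_seqE.
elim: (A : seq _) => [|x s IHs] /=; first by rewrite big1.
rewrite big_split /= IHs (bigD1 x) //= eqxx big1 // => i.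
by rewrite eq_sym => /negPf ->.
Qed.

Lemma in_ksubsets m n k (A : {mset 'I_n}) :
  (A \in ksubsets m n k) =
  (card_mset A == k) && [forall i : 'I_n, le_inf (A i) m].
Proof.
rewrite /ksubsets in_fset /= inE; congr (_ && _); rewrite card_msetE.
apply/imfsetP/eqP => /= [[t _ ->]|sz].
  by rewrite (perm_size (perm_eq_seq_mset t)) size_tuple.
exists (tcast sz (in_tuple A)) => //.
by rewrite val_tcast seq_mset_id.
Qed.

Definition intersecting n (F : {fset {mset 'I_n}}) : Prop :=
  forall A1 A2, A1 \in F -> A2 \in F -> A1 `&` A2 != mset0.

(* The total intersection is folded from a member A0 of F: F must be nonempty,
   in accordance with the convention that the total intersection of the empty
   family is nonempty. *)
Definition total_intersection_empty n (F : {fset {mset 'I_n}}) : Prop :=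
  exists2 A0, A0 \in F & \big[@msetI _/A0]_(A <- F) A = mset0.

Definition nontrivial_intersecting n (F : {fset {mset 'I_n}}) : Prop :=
  intersecting F /\ total_intersection_empty F.

Definition perm_mset n (s : {perm 'I_n}) (A : {mset 'I_n}) : {mset 'I_n} :=
  seq_mset [seq s i | i <- A].

Lemma perm_msetE n (s : {perm 'I_n}) (A : {mset 'I_n}) (i : 'I_n) :
  perm_mset s A (s i) = A i.
Proof.
rewrite -{2}(seq_mset_id A) !mset_seqE count_map.
by apply: eq_count => j /=; rewrite (inj_eq perm_inj).
Qed.

Definition isomorphic n (F' F : {fset {mset 'I_n}}) : Prop :=
  exists s : {perm 'I_n}, F' = [fset perm_mset s A | A in F].

(* {n-k+1, ..., n} *)
Definition Hset (n k : nat) : {mset 'I_n} :=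
  seq_mset [seq i : 'I_n <- enum 'I_n | n - k <= i].

Lemma HsetE n k (i : 'I_n) : Hset n k i = (n - k <= i).
Proof.
rewrite mset_seqE count_uniq_mem; last exact/filter_uniq/enum_uniq.
by rewrite mem_filter mem_enum andbT.
Qed.

Definition EKR (m : option nat) (n k : nat) : {fset {mset 'I_n}} :=
  [fset A : {mset 'I_n} in ksubsets m n k
   | [exists i : 'I_n, (val i == 0) && (i \in (A : {mset 'I_n}))]].

Definition HM (m : option nat) (n k : nat) : {fset {mset 'I_n}} :=
  ([fset A : {mset 'I_n} in EKR m n k | (A `&` Hset n k)%mset != mset0]
   `|` [fset Hset n k])%fset.

(* Main.v *)
(** The number w(s) of multisets of [n]_m of cardinality k with a prescribed
    support of size s depends only on s, so the problem is to bound the total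
    weight of a non-trivial intersecting family of subsets of {1, ..., n} of
    sizes at most k.  Let f_s and h_s count the sets of size s in such a family
    and in the HM-family.  The layers s and t = n - s are treated together:
      - if 2s <= n, then f_s <= h_s, either by the Hilton-Milner theorem for
        s-uniform families, or because the layer is a star at x and some member
        of the family (of size at most k) avoids x;
      - f_s + f_t <= 'C(n, s) <= h_s + h_t, by taking complements;
      - if s <= t <= k, then w(t) <= w(s), because s + t = n >= k + q.
    In the case of equality the layer s = max(2, q) is extremal.  Since s < k,
    the gap in the Hilton-Milner bound shows that this layer is a star, and then
    that a unique member of the family avoids its centre.

    The uniform Hilton-Milner theorem is proved after Frankl and Füredi: shifting
    into a fixed set Y of size 2s makes the members intersect pairwise inside Y,
    and the traces on Y are bounded layer by layer, by induction on s.  If a shift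
    would make the family trivial, then every member contains one of two points x and y, taken in Y;
    after adding all the sets containing both, one shifts only into Y \ {x, y}.

    Compositions of k with t parts at most m are encoded by the sets of starting
    positions of their blocks.  For w(t) <= w(s) one counts the pairs C' <= C of
    such sets of sizes s and t that meet the set of multiples of m in the same
    set. *)

Require Import Defs.
From mathcomp Require Import all_boot all_fingroup.
From mathcomp Require Import finmap multiset.
From mathcomp Require Import zify.

Set Implicit Arguments.
Unset Strict Implicit.
Unset Printing Implicit Defensive.

(** * The Hilton-Milner bound for uniform families of sets *)

Section SetFamilies.
Variable T : finType.
Implicit Types (A B : {set {set T}}) (S G X Y W : {set T}) (x y i j : T).

Definition setfam_intersecting A : Prop :=
  forall S1 S2, S1 \in A -> S2 \in A -> S1 :&: S2 != set0.

Definition setfam_nontrivial A : Prop :=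
  forall x, exists2 S, S \in A & x \notin S.

Definition layer A s : {set {set T}} := [set S in A | #|S| == s].

Lemma setfam_intersecting_sub A B :
  A \subset B -> setfam_intersecting B -> setfam_intersecting A.
Proof. by move=> /subsetP AB iB S1 S2 /AB S1B /AB S2B; apply: iB. Qed.

Lemma layer_sub A s : layer A s \subset A.
Proof. by apply/subsetP=> S; rewrite inE => /andP[]. Qed.

Lemma card_subsets_with Y x s : x \in Y ->
  #|[set S : {set T} | [&& S \subset Y, x \in S & #|S| == s.+1]]|
    = 'C(#|Y|.-1, s).
Proof.
move=> xY.
have -> : #|Y|.-1 = #|Y :\ x| by rewrite (cardsD1 x Y) xY.
rewrite -cards_draws.
have inj : {in [set S : {set T} | S \subset Y :\ x & #|S| == s] &,
    injective (fun S => x |: S)}.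
  move=> S1 S2; rewrite !inE => /andP[/subsetD1P[_ x1] _] /andP[/subsetD1P[_ x2] _].
  by move=> e; rewrite -(setU1K x1) -(setU1K x2) e.
rewrite -(card_in_imset inj); apply: eq_card => S; rewrite inE.
apply/and3P/imsetP => [[SY xS sS]|[S' + ->]].
  exists (S :\ x); last by rewrite setD1K.
  rewrite inE setSD //=; move: sS; rewrite (cardsD1 x S) xS; lia.
rewrite inE => /andP[/subsetD1P[S'Y xS'] /eqP sS']; split.
- by rewrite subUset sub1set xY.
- by rewrite setU11.
by rewrite cardsU1 xS' sS'.
Qed.

(** The sets of size [s.+1] through [x] inside [Y :\: G] belong to the full star but not to [A];
    [#|G| <= K] bounds their number from below. *)
Lemma star_bound A Y G x s K :
    x \in Y -> G \subset Y -> x \notin G -> #|G| <= K ->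
    (forall S, S \in A ->
       [&& S \subset Y, x \in S, #|S| == s.+1 & S :&: G != set0]) ->
  #|A| + 'C(#|Y| - K - 1, s) <= 'C(#|Y| - 1, s).
Proof.
move=> xY GY xG GK hA.
rewrite [X in _ <= 'C(X, _)]subn1 -(card_subsets_with s xY).
set B := [set S : {set T} | [&& S \subset Y :\: G, x \in S & #|S| == s.+1]].
have cB : 'C(#|Y| - K - 1, s) <= #|B|.
  rewrite card_subsets_with ?inE ?xG //.
  apply: leq_bin2l; rewrite cardsDS //; lia.
apply: leq_trans (leq_add (leqnn _) cB) _.
have dAB : [disjoint A & B].
  rewrite disjoint_subset; apply/subsetP => S /hA /and4P[_ _ _ mG].
  rewrite !inE; apply/negP => /and3P[/subsetDP[_ dj] _ _].
  by rewrite setI_eq0 dj in mG.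
have -> : #|A| + #|B| = #|A :|: B|.
  by rewrite cardsU (_ : A :&: B = set0) ?cards0 ?subn0 //; apply/eqP; rewrite setI_eq0.
apply: subset_leq_card; apply/subsetP => S; rewrite !inE.
case/orP => [/hA /and4P[-> -> -> _] //|/and3P[/subsetDP[-> _] -> ->] //].
Qed.

(** The complement in [Y] of a member of [B] misses that member, so it is not in [A]. Hence [A] and
    these complements are disjoint families of [s]-subsets of [Y]. *)
Lemma card_complementary_layers A B Y s t :
    s + t = #|Y| ->
    (forall S, S \in A -> (S \subset Y) && (#|S| == s)) ->
    (forall S, S \in B -> (S \subset Y) && (#|S| == t)) ->
    (forall S1 S2, S1 \in A -> S2 \in B -> S1 :&: S2 != set0) ->
  #|A| + #|B| <= 'C(#|Y|, s).
Proof.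
move=> st hA hB hAB.
have inj : {in B &, injective (fun S => Y :\: S)}.
  move=> S1 S2 /hB /andP[s1 _] /hB /andP[s2 _] e.
  by rewrite -(setIidPr s1) -(setIidPr s2) -(set0U (_ :&: S1)) -(set0U (_ :&: S2)) -(setDv Y) -!setDDr e.
rewrite -(card_in_imset inj) -cards_draws.
have dj : [disjoint A & [set Y :\: S | S in B]].
  rewrite disjoint_subset; apply/subsetP => S SA; rewrite !inE.
  apply/negP => /imsetP[S2 S2B e]; have := hAB _ _ SA S2B.
  by rewrite e setI_eq0 disjoint_sym disjoints_subset setDE setCI setCK subsetU ?subxx ?orbT.
have -> : #|A| + #|[set Y :\: S | S in B]| = #|A :|: [set Y :\: S | S in B]|.
  by rewrite cardsU (_ : _ :&: _ = set0) ?cards0 ?subn0 //; apply/eqP; rewrite setI_eq0.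
apply: subset_leq_card; apply/subsetP => S; rewrite !inE.
case/orP => [/hA //|/imsetP[S' /hB /andP[S'Y /eqP cS'] ->]].
rewrite subsetDl cardsDS //; lia.
Qed.

Lemma ltn_bin2l a b c : 0 < c -> c <= b -> a < b -> 'C(a, c) < 'C(b, c).
Proof.
case: c b => // c [//|b] _ cb ab; rewrite binS.
have := @leq_bin2l a b c.+1; have : 0 < 'C(b, c) by rewrite bin_gt0; lia.
lia.
Qed.

(** The classical bound, written additively so that no binomial is subtracted. *)
Definition hilton_milner_at Y s : Prop := forall A,
  (forall S, S \in A -> (S \subset Y) && (#|S| == s)) ->
  setfam_intersecting A -> setfam_nontrivial A ->
  #|A| + 'C(#|Y| - s - 1, s - 1) <= 'C(#|Y| - 1, s - 1) + 1.

Lemma nontrivial_or_star A :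
  setfam_nontrivial A \/ exists x, forall S, S \in A -> x \in S.
Proof.
case: (boolP [forall x, [exists S in A, x \notin S]]) => [/forallP h|].
  by left => x; have /exists_inP[S] := h x; exists S.
rewrite negb_forall => /existsP[x]; rewrite negb_exists_in => /forall_inP h.
by right; exists x => S /h; rewrite negbK.
Qed.

(** A nontrivial layer obeys its own Hilton-Milner bound; a layer that is a star at [x] is handled
    by [star_bound] with a member of [A] that avoids [x]. The [+ 1] of Hilton-Milner survives only
    in the top layer. *)
Lemma layer_bound A Y K s :
    hilton_milner_at Y s ->
    (forall S, S \in A -> (S \subset Y) && (#|S| <= K)) ->
    setfam_intersecting A -> setfam_nontrivial A ->
    s <= K -> 2 * s <= #|Y| ->
  #|layer A s| + 'C(#|Y| - K - 1, s - 1) <= 'C(#|Y| - 1, s - 1) + (s == K).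
Proof.
move=> hm hA iA ntA sK s2.
have iL := setfam_intersecting_sub (layer_sub A s) iA.
have hL S : S \in layer A s -> [&& S \in A, S \subset Y & #|S| == s].
  by rewrite inE => /andP[SA ->]; rewrite SA; have /andP[->] := hA _ SA.
have [L0|/set0Pn[S0 S0L]] := eqVneq (layer A s) set0.
  by rewrite L0 cards0; apply: leq_trans (leq_addr _ _); apply: leq_bin2l; lia.
have s_gt0 : 0 < s.
  have := iL _ _ S0L S0L; rewrite setIid -card_gt0.
  by have /and3P[_ _ /eqP ->] := hL _ S0L.
case: s s_gt0 hm sK s2 iL hL S0L => // s _ hm sK s2 iL hL S0L.
rewrite (_ : s.+1 - 1 = s); last by rewrite subn1.
have [ntL|[x hx]] := nontrivial_or_star (layer A s.+1).
  have {}hm := hm _ (fun S SL => proj2 (andP (hL S SL))) iL ntL.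
  have [e|neK] := eqVneq s.+1 K; first by move: hm; rewrite -e (_ : s.+1 - 1 = s); lia.
  have s_gt0 : 0 < s.
    rewrite lt0n; apply/eqP => s0; have /and3P[_ _] := hL _ S0L.
    rewrite s0 => /cards1P[x S0x]; have [S SL] := ntL x.
    have := iL _ _ S0L SL; rewrite S0x => /set0Pn[y]; rewrite !inE.
    by case/andP => /eqP -> ->.
  (* As [s.+1 < K], the binomial subtracted by Hilton-Milner strictly exceeds the one required here,
     which absorbs the [+ 1]. *)
  have := @ltn_bin2l (#|Y| - K - 1) (#|Y| - s.+1 - 1) s s_gt0.
  by move: hm; rewrite (_ : s.+1 - 1 = s); lia.
have [G GA xG] := ntA x; have /andP[GY GK] := hA _ GA.
apply: leq_trans (leq_addr _ _); apply: (@star_bound _ _ G x) => //.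
  by have /and3P[_ /subsetP SY _] := hL _ S0L; apply/SY/hx.
move=> S SL; have /and3P[SA -> ->] := hL _ SL; rewrite (hx _ SL) /=.
exact: iA.
Qed.

(** For [s > 0], [A] has at most one set of each complementary pair, hence at most half of
    ['C(2 * s, s)]; the other binomial is 1 and cancels the [+ 1]. *)
Lemma hilton_milner_half Y s : #|Y| = 2 * s -> hilton_milner_at Y s.
Proof.
move=> Y2 A hA iA _.
have := @card_complementary_layers A A Y s s _ hA hA iA.
rewrite Y2; case: s Y2 {hA} => [|s] Y2 h; first by move: (h erefl); rewrite muln0 !sub0n !bin0; lia.
have {}h : #|A| + #|A| <= 'C(2 * s.+1, s.+1) by apply: h; lia.
have e1 : 2 * s.+1 = (s + s.+1).+1 by lia.
rewrite e1 binS in h.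
have e2 := bin_sub (leq_addr s.+1 s); rewrite addKn in e2.
have -> : 2 * s.+1 - s.+1 - 1 = s by lia.
have -> : s.+1 - 1 = s by lia.
have -> : 2 * s.+1 - 1 = s + s.+1 by lia.
rewrite binn leq_add2r -leq_double -!addnn; apply: leq_trans h _.
by rewrite e2.
Qed.

(** The traces on [Y] form a nontrivial intersecting family of sets of size at most [s], controlled
    by [layer_bound]. A trace of size [j] comes from at most ['C(#|Y0| - 2 * s, s - j)] members, and
    Vandermonde's identity sums the bounds. *)
Lemma trace_bound A Y0 Y s :
    (forall s', s' < s -> hilton_milner_at Y s') ->
    Y \subset Y0 -> #|Y| = 2 * s -> 0 < s ->
    (forall S, S \in A -> (S \subset Y0) && (#|S| == s)) ->
    (forall S1 S2, S1 \in A -> S2 \in A -> S1 :&: S2 :&: Y != set0) ->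
    setfam_nontrivial A ->
  #|A| + 'C(#|Y0| - s - 1, s - 1) <= 'C(#|Y0| - 1, s - 1) + 1.
Proof.
move=> IH YY0 Y2 s_gt0 hA iA ntA.
pose B := [set S :&: Y | S in A].
have hB S : S \in B -> (S \subset Y) && (#|S| <= s).
  case/imsetP=> S' S'A ->; rewrite subsetIr /=.
  have /andP[_ /eqP <-] := hA _ S'A; exact: subset_leq_card (subsetIl _ _).
have iB : setfam_intersecting B.
  move=> _ _ /imsetP[S1 S1A ->] /imsetP[S2 S2A ->].
  by rewrite setIACA setIid; apply: iA.
have ntB : setfam_nontrivial B.
  move=> x; have [S SA xS] := ntA x; exists (S :&: Y); first exact: imset_f.
  by rewrite inE negb_and xS.
(* [layer_bound] with [K := s]: the layer [j = s] is the case of complementary pairs, the smaller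
   ones come from [IH]. *)
have lB (j : nat) : j <= s -> #|layer B j| + 'C(s - 1, j - 1) <= 'C(2 * s - 1, j - 1) + (j == s).
  move=> js; have := @layer_bound B Y s j _ hB iB ntB js; rewrite Y2.
  rewrite (_ : 2 * s - s - 1 = s - 1); last lia.
  apply; last lia.
  move: js; rewrite leq_eqVlt => /predU1P[->|]; last exact: IH.
  exact: hilton_milner_half.
set n := #|Y0|.
have n2 : 2 * s <= n by rewrite -Y2; apply: subset_leq_card.
have cA : #|A| <= \sum_(j < s) #|layer B j.+1| * 'C(n - 2 * s, s - j.+1).
  have cf S : S \in B -> #|[set S' in A | S' :&: Y == S]| <= 'C(n - 2 * s, s - #|S|).
    move=> SB; rewrite -[X in _ <= 'C(X - _, _)]/n -Y2 -cardsDS // -cards_draws.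
    have inj : {in [set S' in A | S' :&: Y == S] &, injective (fun S => S :\: Y)}.
      move=> S1 S2; rewrite !inE => /andP[_ /eqP e1] /andP[_ /eqP e2] e.
      by rewrite -(setID S1 Y) -(setID S2 Y) e1 e2 e.
    rewrite -(card_in_imset inj); apply: subset_leq_card; apply/subsetP => _ /imsetP[S' + ->].
    rewrite !inE => /andP[S'A /eqP <-]; have /andP[S'Y /eqP <-] := hA _ S'A.
    by rewrite setSD //= -(cardsID Y S') addKn.
  have -> : #|A| = \sum_(S in B) #|[set S' in A | S' :&: Y == S]|.
    rewrite -sum1_card (partition_big (fun S => S :&: Y) (mem B)) /=; last first.
      by move=> S SA; apply: imset_f.
    by apply: eq_bigr => S SB; rewrite -sum1_card; apply: eq_bigl => S'; rewrite !inE.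
  apply: leq_trans (leq_sum _ cf) _.
  (* Traces are nonempty, so the summation index [j] stands for the size [j.+1]. *)
  have hs S : S \in B -> 0 < #|S| <= s.
    move=> SB; have /andP[_ ->] := hB _ SB; have := iB _ _ SB SB.
    by rewrite setIid -card_gt0 => ->.
  have [s' es] : exists s', s = s'.+1 by exists s.-1; lia.
  rewrite -(big_mkord xpredT (fun j : nat => #|layer B j.+1| * 'C(n - 2 * s, s - j.+1))).
  rewrite [X in index_iota _ X]es big_mkord.
  rewrite (partition_big (fun S => inord #|S|.-1 : 'I_s'.+1) predT) //=.
  apply: leq_sum => j _.
  rewrite (eq_bigl (fun S => S \in layer B j.+1)); last first.
    move=> S; rewrite !inE; case SB: (S \in B) => //=.
    have := hs _ SB; rewrite es => hS; rewrite -val_eqE /= inordK; lia.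
  rewrite (eq_bigr (fun=> 'C(n - 2 * s, s - j.+1))) ?sum_nat_const //.
  by move=> S; rewrite inE => /andP[_ /eqP ->].
(* Used with [a = s - 1] and [a = 2 * s - 1], which produce the two binomials of the conclusion. *)
have vdm (a : nat) : \sum_(j < s) 'C(a, j) * 'C(n - 2 * s, s - j.+1) = 'C(a + (n - 2 * s), s - 1).
  rewrite -Vandermonde; have [s' es] : exists s', s = s'.+1 by exists s.-1; lia.
  rewrite es subn1 /=; apply: eq_bigr => j _; congr (_ * 'C(_, _)).
have sumle : \sum_(j < s) (#|layer B j.+1| + 'C(s - 1, j)) * 'C(n - 2 * s, s - j.+1)
   <= \sum_(j < s) ('C(2 * s - 1, j) + (j.+1 == s)) * 'C(n - 2 * s, s - j.+1).
  apply: leq_sum => j _; rewrite leq_mul2r; apply/orP; right.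
  by have := lB j.+1 (ltn_ord j); rewrite (_ : j.+1 - 1 = j) ?subn1.
move: sumle; under eq_bigr do rewrite mulnDl.
under [X in _ <= X]eq_bigr do rewrite mulnDl.
rewrite !big_split /= !vdm.
have -> : \sum_(j < s) (j.+1 == s) * 'C(n - 2 * s, s - j.+1) = 1.
  have [s' es] : exists s', s = s'.+1 by exists s.-1; lia.
  rewrite es big_ord_recr /= eqxx subnn bin0 big1 ?add0n // => j _.
  by rewrite eqSS ltn_eqF.
rewrite (_ : s - 1 + (n - 2 * s) = n - s - 1); last lia.
rewrite (_ : 2 * s - 1 + (n - 2 * s) = n - 1); last lia.
by move=> h; apply: leq_trans h; rewrite leq_add2r.
Qed.

End SetFamilies.

(** * Shifting into a fixed set, and the uniform Hilton-Milner theorem *)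

Section Shifting.
Variable T : finType.
Implicit Types (A B : {set {set T}}) (S G X Y W : {set T}) (x y i j : T).

Definition swap_in i j S := i |: (S :\ j).

Definition shift1 i j A S :=
  if [&& j \in S, i \notin S & swap_in i j S \notin A] then swap_in i j S else S.

Definition shift i j A := shift1 i j A @: A.

Variant shift1_spec i j A S : {set T} -> Type :=
| ShiftMoved of j \in S & i \notin S & swap_in i j S \notin A :
    shift1_spec i j A S (swap_in i j S)
| ShiftKept of (j \in S -> i \notin S -> swap_in i j S \in A) :
    shift1_spec i j A S S.

Lemma shift1P i j A S : shift1_spec i j A S (shift1 i j A S).
Proof.
rewrite /shift1; case: (boolP (j \in S)) => /= [jS|jS]; last by apply: ShiftKept; rewrite (negPf jS).
case: (boolP (i \in S)) => /= [iS|iS]; first by apply: ShiftKept; rewrite iS.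
by case: (boolP (swap_in i j S \in A)) => /= sA; [apply: ShiftKept|apply: ShiftMoved].
Qed.

Lemma in_swap_in i j S x : (x \in swap_in i j S) = (x == i) || (x != j) && (x \in S).
Proof. by rewrite !inE. Qed.

Lemma swap_inK i j S : j \in S -> i \notin S -> swap_in j i (swap_in i j S) = S.
Proof.
move=> jS iS; apply/setP => x; rewrite !in_swap_in.
have [->|xj] := eqVneq x j; first by rewrite jS.
by have [->|xi] := eqVneq x i; rewrite ?(negPf iS).
Qed.

Lemma card_swap_in i j S : j \in S -> i \notin S -> #|swap_in i j S| = #|S|.
Proof.
move=> jS iS; rewrite /swap_in cardsU1 !inE (negPf iS) andbF.
by rewrite [RHS](cardsD1 j) jS.
Qed.

Lemma swap_in_sub i j S Y : i \in Y -> S \subset Y -> swap_in i j S \subset Y.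
Proof.
by move=> iY SY; rewrite subUset sub1set iY (subset_trans (subsetDl _ _)).
Qed.

(** A moved set lands outside [A] and a kept one stays inside, so the two kinds never collide; on
    moved sets the swap can be undone. *)
Lemma shift1_inj i j A : {in A &, injective (shift1 i j A)}.
Proof.
move=> S1 S2; case: shift1P => [j1 i1 n1|_] S1A; case: shift1P => [j2 i2 n2|_] S2A.
- by move=> e; rewrite -(swap_inK j1 i1) e swap_inK.
- by move=> e; rewrite e S2A in n1.
- by move=> e; rewrite -e S1A in n2.
- by [].
Qed.

Lemma card_shift i j A : #|shift i j A| = #|A|.
Proof. exact: card_in_imset (@shift1_inj i j A). Qed.

Lemma card_shift1 i j A S : #|shift1 i j A S| = #|S|.
Proof. by case: shift1P => // *; apply: card_swap_in. Qed.

Lemma shift1_sub i j A S Y : i \in Y -> S \subset Y -> shift1 i j A S \subset Y.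
Proof. by case: shift1P => // *; apply: swap_in_sub. Qed.

(** Two moved sets share [i]. If [S1] moves while [S2] stays with [j] but without [i], then
    [swap_in i j S2] is in [A], and its common points with [S1] are neither [i] nor [j]. *)
Lemma shift_intersecting i j A :
  setfam_intersecting A -> setfam_intersecting (shift i j A).
Proof.
move=> iA.
suff mk S1 S2 : S1 \in A -> S2 \in A -> j \in S1 -> i \notin S1 ->
    (j \in S2 -> i \notin S2 -> swap_in i j S2 \in A) ->
    swap_in i j S1 :&: S2 != set0.
  move=> _ _ /imsetP[S1 S1A ->] /imsetP[S2 S2A ->].
  case: shift1P => [j1 i1 n1|k1]; case: shift1P => [j2 i2 n2|k2].
  - by apply/set0Pn; exists i; rewrite inE !in_swap_in eqxx.
  - exact: mk.
  - by rewrite setIC; apply: mk.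
  - exact: iA.
move=> S1A S2A j1 i1 k2.
case: (boolP (i \in S2)) => [i2|i2].
  by apply/set0Pn; exists i; rewrite inE in_swap_in eqxx.
case: (boolP (j \in S2)) => [j2|j2].
  have /set0Pn[z] := iA _ _ S1A (k2 j2 i2).
  rewrite inE in_swap_in => /andP[z1]; have [e|_ /= /andP[zj z2]] := eqVneq z i.
    by rewrite -e z1 in i1.
  by apply/set0Pn; exists z; rewrite inE in_swap_in zj z1 z2 orbT.
have /set0Pn[z] := iA _ _ S1A S2A; rewrite inE => /andP[z1 z2].
apply/set0Pn; exists z; rewrite inE in_swap_in z1 z2 !andbT.
by apply/orP; right; apply: contraNneq j2 => <-.
Qed.

(** [W] is separate from [Y] so that the two covering points in [hilton_milner_cover] can be
    excluded as targets. *)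
Definition shift_stable Y W A : Prop :=
  forall i j S, i \in W -> j \notin Y -> S \in A -> j \in S -> i \notin S ->
    swap_in i j S \in A.

Lemma shift_trace_size Y i j A S :
    i \in Y -> j \notin Y -> S \in A -> j \in S -> i \notin S ->
    swap_in i j S \notin A ->
  \sum_(S' in A) #|S' :&: Y| < \sum_(S' in shift i j A) #|S' :&: Y|.
Proof.
move=> iY jY SA jS iS nA; rewrite big_imset /=; last exact: shift1_inj.
have trY S' : S' :&: Y \subset swap_in i j S' :&: Y.
  apply/subsetP => z; rewrite !inE => /andP[zS zY].
  rewrite zY zS !andbT; apply/orP; right; by apply: contraNneq jY => <-.
rewrite (bigD1 S SA) [X in _ < X](bigD1 S SA) /= -addSn; apply: leq_add.
  rewrite /shift1 jS iS nA; apply: proper_card; apply/properP; split=> //.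
  by exists i; rewrite !inE ?eqxx // (negPf iS).
apply: leq_sum => S' _; apply: subset_leq_card.
by case: shift1P => // *; apply: trY.
Qed.

(** [P] is the invariant, and [Q] the escape for a family whose shift would lose [P]. Each effective
    shift raises the total trace size on [Y], which is at most [#|A| * #|T|]. *)
Lemma stabilize (P Q : {set {set T}} -> Prop) Y W A :
    W \subset Y ->
    (forall B i j, P B -> i \in W -> j \notin Y -> P (shift i j B) \/ Q B) ->
    P A ->
  exists B, [/\ P B, #|B| = #|A| & shift_stable Y W B \/ Q B].
Proof.
move=> /subsetP WY PQ.
pose pot B := \sum_(S in B) #|S :&: Y|.
have pot_le B : pot B <= #|B| * #|T|.
  by rewrite -sum_nat_const; apply: leq_sum => S _; apply: max_card.
have step B : P B -> [\/ shift_stable Y W B, Q B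
    | exists B', [/\ P B', #|B'| = #|B| & pot B < pot B']].
  move=> PB; case: (boolP [forall i in W, forall j in ~: Y, forall S in B,
      (j \in S) ==> (i \notin S) ==> (swap_in i j S \in B)]) => [/forall_inP st|].
    apply: Or31 => i j S iW jY SB jS iS.
    have /forall_inP/(_ j) := st _ iW; rewrite inE => /(_ jY)/forall_inP/(_ _ SB).
    by rewrite jS iS.
  rewrite negb_forall_in => /exists_inP[i iW]; rewrite negb_forall_in.
  move=> /exists_inP[j]; rewrite inE negb_forall_in => jY /exists_inP[S SB].
  rewrite !negb_imply => /and3P[jS iS nB].
  have [PS|QB] := PQ B i j PB iW jY; last exact: Or32.
  apply: Or33; exists (shift i j B); split; rewrite ?card_shift //.
  exact: (shift_trace_size (WY _ iW) jY SB jS iS nB).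
have [N] : exists N, #|A| * #|T| - pot A < N by exists (#|A| * #|T|).+1; lia.
elim: N A => [//|N IHN] A hN PA.
have [st|QA|[B [PB cB ltB]]] := step A PA.
- by exists A; split=> //; left.
- by exists A; split=> //; right.
have [|C [PC cC hC]] := IHN _ _ PB; first by have := pot_le B; rewrite cB; lia.
by exists C; rewrite -cB.
Qed.

(** If [S1] and [S2] meet only outside [Y], say at [j], the counting hypothesis leaves a point [i]
    of [W] outside both. Then [swap_in i j S1] is a member that meets [S2] in fewer points, still
    none in [Y]; induction on the size of the intersection. *)
Lemma stable_intersecting_trace Y W A :
    W \subset Y -> setfam_intersecting A -> shift_stable Y W A ->
    (forall S1 S2 j, S1 \in A -> S2 \in A -> j \in S1 -> j \in S2 ->
       S1 :&: S2 :&: Y = set0 -> #|S1 :&: W| + #|S2 :&: W| < #|W|) ->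
  forall S1 S2, S1 \in A -> S2 \in A -> S1 :&: S2 :&: Y != set0.
Proof.
move=> /subsetP WY iA st hW S1 S2.
have [N] : exists N, #|S1 :&: S2| <= N by eexists.
elim: N S1 => [|N IHN] S1 hN S1A S2A.
  by move: hN; rewrite leqNgt card_gt0 iA.
apply/negP => /eqP e.
have /set0Pn[j] := iA _ _ S1A S2A; rewrite inE => /andP[j1 j2].
have jY : j \notin Y.
  by apply/negP => jY; have := in_set0 j; rewrite -e !inE j1 j2 jY.
have [i iW] : exists2 i, i \in W & i \notin S1 :|: S2.
  apply/subsetPn; apply/negP => /setIidPl hS.
  have := hW _ _ _ S1A S2A j1 j2 e; apply/negP; rewrite -leqNgt.
  rewrite -{1}hS setIC setIUl; exact: (leq_card_setU (S1 :&: W) (S2 :&: W)).1.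
rewrite inE negb_or => /andP[i1 i2].
have S1A' := st _ _ _ iW jY S1A j1 i1.
suff : swap_in i j S1 :&: S2 :&: Y != set0.
  case/set0Pn => z; rewrite !inE => /andP[/andP[/orP[/eqP ->|/andP[_ z1] z2 zY]]].
    by rewrite (negPf i2).
  by have := in_set0 z; rewrite -e !inE z1 z2 zY.
apply: IHN => //; rewrite -ltnS; apply: leq_trans hN.
rewrite [X in _ < X](cardsD1 j) inE j1 j2 ltnS.
apply/subset_leq_card/subsetP => z; rewrite !inE => /andP[/orP[/eqP ->|/andP[-> ->] ->//]].
by rewrite (negPf i2).
Qed.

Lemma superset_of_size X Y m : X \subset Y -> #|X| <= m <= #|Y| ->
  exists2 Z : {set T}, (X \subset Z) && (Z \subset Y) & #|Z| = m.
Proof.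
move=> XY /andP[Xm mY].
have : 0 < 'C(#|Y :\: X|, m - #|X|) by rewrite bin_gt0 cardsDS //; lia.
rewrite -cards_draws card_gt0 => /set0Pn[Z]; rewrite inE => /andP[/subsetDP[ZY dZ] /eqP cZ].
exists (X :|: Z); first by rewrite subsetUl subUset XY.
rewrite cardsU (_ : X :&: Z = set0); first by rewrite cards0 cZ; lia.
by apply/eqP; rewrite setI_eq0 disjoint_sym.
Qed.

(** All sets through both [x] and [y] can be added without losing the intersection property.
    Shifting only into [W], away from [x] and [y], preserves the members avoiding [x] or [y], so no
    escape is possible. *)
Lemma hilton_milner_cover A Y0 s x y :
    (forall s' Y, s' < s -> 2 * s' <= #|Y| -> hilton_milner_at Y s') ->
    1 < s -> 2 * s <= #|Y0| -> x != y ->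
    (forall S, S \in A -> (S \subset Y0) && (#|S| == s)) ->
    setfam_intersecting A -> setfam_nontrivial A ->
    (forall S, S \in A -> (x \in S) || (y \in S)) ->
  #|A| + 'C(#|Y0| - s - 1, s - 1) <= 'C(#|Y0| - 1, s - 1) + 1.
Proof.
move=> IH s_gt1 n2 xy hA iA ntA cA.
have [Sx SxA xSx] := ntA x; have [Sy SyA ySy] := ntA y.
have xY0 : x \in Y0.
  have /andP[/subsetP SY _] := hA _ SyA; apply: SY.
  by have := cA _ SyA; rewrite (negPf ySy) orbF.
have yY0 : y \in Y0.
  have /andP[/subsetP SY _] := hA _ SxA; apply: SY.
  by have := cA _ SxA; rewrite (negPf xSx).
pose full := [set S : {set T} | [&& S \subset Y0, #|S| == s, x \in S & y \in S]].
pose A1 := A :|: full.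
pose P B := [/\ setfam_intersecting B,
  (forall S, S \in B -> [&& S \subset Y0, #|S| == s & (x \in S) || (y \in S)]),
  full \subset B, (exists2 S, S \in B & x \notin S) & (exists2 S, S \in B & y \notin S)].
have [Y /andP[xyY YY0] cY] : exists2 Y : {set T}, ([set x; y] \subset Y) && (Y \subset Y0) & #|Y| = 2 * s.
  apply: (@superset_of_size [set x; y] Y0 (2 * s)); first by rewrite subUset !sub1set xY0.
  by rewrite cards2 xy; lia.
have xY : x \in Y by move/subsetP: xyY; apply; rewrite !inE eqxx.
have yY : y \in Y by move/subsetP: xyY; apply; rewrite !inE eqxx orbT.
pose W := Y :\ x :\ y.
have WY : W \subset Y by rewrite !subDset setUA subsetUr.
have cW : #|W| = 2 * s - 2.
  by have := cardsD1 x Y; have := cardsD1 y (Y :\ x); rewrite !inE xY yY eq_sym xy -/W cY; lia.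
have PA1 : P A1.
  split.
  - move=> S1 S2; rewrite !inE => /orP[S1A|/and4P[_ _ x1 y1]] /orP[S2A|/and4P[_ _ x2 y2]].
    + exact: iA.
    + by have /orP[z|z] := cA _ S1A; apply/set0Pn; [exists x|exists y]; rewrite inE z.
    + by have /orP[z|z] := cA _ S2A; apply/set0Pn; [exists x|exists y]; rewrite inE z andbT.
    + by apply/set0Pn; exists x; rewrite inE x1.
  - move=> S; rewrite !inE => /orP[SA|/and4P[-> -> -> _] //].
    by have /andP[-> ->] := hA _ SA; rewrite cA.
  - exact: subsetUr.
  - by exists Sx; rewrite // inE SxA.
  - by exists Sy; rewrite // inE SyA.
have Pshift B i j : P B -> i \in W -> j \notin Y -> P (shift i j B) \/ False.
  move=> [iB hB fB [S1 S1B x1] [S2 S2B y2]] iW jY; left.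
  have jx : x != j by apply: contraNneq jY => <-.
  have jy : y != j by apply: contraNneq jY => <-.
  have [iy ix iY] : [/\ y != i, x != i & i \in Y].
    by move: iW; rewrite !inE => /and3P[? ? ?]; split=> //; rewrite eq_sym.
  have hx S : (x \in shift1 i j B S) = (x \in S).
    by case: shift1P => // *; rewrite in_swap_in (negPf ix) jx.
  have hy S : (y \in shift1 i j B S) = (y \in S).
    by case: shift1P => // *; rewrite in_swap_in (negPf iy) jy.
  have iY0 : i \in Y0 by move/subsetP: YY0; apply.
  split.
  - exact: shift_intersecting.
  - move=> _ /imsetP[S /hB /and3P[SY0 cS hS] ->].
    by rewrite hx hy card_shift1 cS hS shift1_sub.
  (* A swap of a member of [full] is again in [full], hence in [B]; so that member does not move. *)
  - apply/subsetP => S Sf; move/subsetP: (fB) => /(_ _ Sf) SB.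
    apply/imsetP; exists S => //; case: shift1P => // jS iS nB.
    case/negP: nB; move/subsetP: (fB); apply.
    move: Sf; rewrite !inE => /and4P[SY cS xS yS].
    by rewrite swap_in_sub // card_swap_in // cS jx jy xS yS !orbT.
  - by exists (shift1 i j B S1); rewrite ?imset_f // hx.
  - by exists (shift1 i j B S2); rewrite ?imset_f // hy.
have [B [[iB hB fB nx ny] cB [st|//]]] := stabilize WY Pshift PA1.
have AB : #|A| <= #|B| by rewrite cB; apply: subset_leq_card; apply: subsetUl.
apply: leq_trans (leq_add AB (leqnn _)) _.
apply: (@trace_bound _ B Y0 Y s) => //.
- by move=> s' s's; apply: IH => //; rewrite cY leq_mul2l ltnW.
- exact: ltnW.
- by move=> S /hB /and3P[-> ->].
- apply: stable_intersecting_trace WY iB st _ => S1 S2 j S1B S2B j1 j2 e.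
  have jY : j \notin Y.
    by apply/negP => jY; have := in_set0 j; rewrite -e !inE j1 j2 jY.
  (* Each member through [j] has two points outside [W]: [j], and one of [x], [y]. Two members thus
     cover at most [2 * s - 4] points of [W], which has [2 * s - 2]. *)
  suff h S : S \in B -> j \in S -> #|S :&: W| + 2 <= s.
    by move: (h _ S1B j1) (h _ S2B j2); rewrite cW; clear -s_gt1; lia.
  move=> SB jS; have /and3P[_ /eqP <- xyS] := hB _ SB.
  have [z zS zxy] : exists2 z, z \in S & z \in [set x; y].
    by case/orP: xyS => ?; [exists x|exists y]; rewrite // !inE eqxx ?orbT.
  have zj : z != j by apply: contraNneq jY => <-; move/subsetP: xyY; apply.
  rewrite (cardsD1 z S) zS (cardsD1 j (S :\ z)) !inE eq_sym zj jS addnC.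
  rewrite addnA leq_add2l; apply/subset_leq_card/subsetP => u; rewrite !inE.
  case/and4P=> uS uy ux uY; rewrite uS andbT; apply/andP; split.
    by apply: contraNneq jY => <-.
  by move: zxy; rewrite !inE => /orP[] /eqP ->.
(* For [z] other than [x] and [y], [full] contains a set avoiding [z]. *)
- move=> z; have [->|zx] := eqVneq z x => //.
  have [->|zy] := eqVneq z y => //.
  have [S /andP[xyS SY] cS] : exists2 S : {set T}, ([set x; y] \subset S) && (S \subset Y0 :\ z) & #|S| = s.
    apply: superset_of_size.
      by rewrite subUset !sub1set !inE xY0 yY0 eq_sym zx eq_sym zy.
    rewrite cards2 xy s_gt1; move: (cardsD1 z Y0) n2.
    by case: (z \in Y0); clear -s_gt1; lia.
  move: SY => /subsetD1P[SY zS]; exists S => //.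
  move/subsetP: fB; apply; rewrite inE SY cS eqxx /=.
  by move: xyS; rewrite subUset !sub1set.
Qed.

Theorem hilton_milner Y0 s : 2 * s <= #|Y0| -> hilton_milner_at Y0 s.
Proof.
elim/ltn_ind: s Y0 => s IH Y0 n2 A hA iA ntA.
have {}IH s' Y : s' < s -> 2 * s' <= #|Y| -> hilton_milner_at Y s'.
  by move=> lts; apply: IH.
have [A0|/set0Pn[S0 S0A]] := eqVneq A set0.
  rewrite A0 cards0; apply: leq_trans (leq_addr _ _); apply: leq_bin2l.
  exact/leq_sub2r/leq_subr.
have s_gt0 : 0 < s.
  have := iA _ _ S0A S0A; rewrite setIid -card_gt0.
  by have /andP[_ /eqP ->] := hA _ S0A.
have [Y /andP[_ YY0] cY] : exists2 Y : {set T}, (set0 \subset Y) && (Y \subset Y0) & #|Y| = 2 * s.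
  by apply: superset_of_size; rewrite ?sub0set // cards0.
pose P B := [/\ setfam_intersecting B,
  (forall S, S \in B -> (S \subset Y0) && (#|S| == s)) & setfam_nontrivial B].
pose Q B := exists xy : T * T, forall S, S \in B -> (xy.1 \in S) || (xy.2 \in S).
have Pshift B i j : P B -> i \in Y -> j \notin Y -> P (shift i j B) \/ Q B.
  move=> [iB hB ntB] iY jY.
  (* If the shifted family is a star at [z], a member of [B] avoiding [z] must have moved, so
     [z = i]; hence every member of [B] contains [i] or [j]. *)
  have [nt|[z hz]] := nontrivial_or_star (shift i j B).
    left; split=> //; first exact: shift_intersecting.
    move=> _ /imsetP[S /hB /andP[SY0 cS] ->]; rewrite card_shift1 cS andbT.
    by apply: shift1_sub => //; move/subsetP: YY0; apply.
  right; have {}hz S : S \in B -> z \in shift1 i j B S by move=> SB; apply/hz/imset_f.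
  exists (i, j) => S SB /=.
  have [S' S'B zS'] := ntB z; have := hz _ S'B.
  case: shift1P => [jS' iS' nB|_]; last by rewrite (negPf zS').
  rewrite in_swap_in (negPf zS') andbF orbF => /eqP zi.
  have := hz _ SB; rewrite zi; case: shift1P => [-> _ _|_ ->] //.
  by rewrite orbT.
have PA : P A by split.
have [B [[iB hB ntB] <- [st|[[x y] cB]]]] := stabilize (subxx Y) Pshift PA.
  apply: (@trace_bound _ B Y0 Y s) => //.
    by move=> s' s's; apply: IH => //; rewrite cY leq_mul2l ltnW.
  apply: stable_intersecting_trace (subxx Y) iB st _ => S1 S2 j S1B S2B j1 j2 e.
  have jY : j \notin Y.
    by apply/negP => jY; have := in_set0 j; rewrite -e !inE j1 j2 jY.
  have h S : S \in B -> j \in S -> #|S :&: Y| + 1 <= s.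
    move=> SB jS; have /andP[_ /eqP <-] := hB _ SB.
    rewrite (cardsD1 j S) jS addnC leq_add2l; apply/subset_leq_card/subsetP => u.
    rewrite !inE => /andP[-> uY]; rewrite andbT.
    by apply: contraNneq jY => <-.
  by move: (h _ S1B j1) (h _ S2B j2); rewrite cY; clear; lia.
have xy : x != y.
  apply/eqP => xy; have [S SB] := ntB x; have := cB _ SB.
  by rewrite /= -xy orbb => ->.
apply: (hilton_milner_cover IH _ n2 xy hB iB ntB cB).
(* If [s] were 1, the members avoiding [x] and [y] would be the disjoint singletons of [y] and
   [x]. *)
rewrite ltn_neqAle s_gt0 andbT eq_sym; apply/eqP => s1.
have [S SB xS] := ntB x; have [S' S'B yS'] := ntB y.
have := cB _ SB; have := cB _ S'B; rewrite /= (negPf xS) (negPf yS') orbF /= => xS' yS.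
have /andP[_] := hB _ SB; rewrite s1 => /cards1P[u Su].
have /andP[_] := hB _ S'B; rewrite s1 => /cards1P[v S'v].
have := iB _ _ SB S'B; rewrite Su S'v; move: xS' yS xy; rewrite Su S'v !inE.
by move=> /eqP -> /eqP -> vu /set0Pn[w]; rewrite !inE => /andP[/eqP -> /eqP uv]; rewrite uv eqxx in vu.
Qed.

End Shifting.

(** * The weighted bound for families of sets of size at most k *)

Section WeightedHiltonMilner.
Variable T : finType.
Implicit Types (A B : {set {set T}}) (S G H : {set T}) (x y : T) (s t k : nat).

Definition hm_family x H k : {set {set T}} :=
  [set S : {set T} | [&& #|S| <= k, x \in S & S :&: H != set0]] :|: [set H].

Lemma in_hm_family x H k S : (S \in hm_family x H k) =
  [&& #|S| <= k, x \in S & S :&: H != set0] || (S == H).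
Proof. by rewrite !inE. Qed.

(** Counterpart of [layer_bound]: the star at [x] without the sets that miss [H], together with [H]
    in the layer [k]. *)
Lemma hm_layer_ge x H k s : x \notin H -> #|H| = k -> s.+1 <= k ->
  'C(#|T| - 1, s) + (s.+1 == k) <=
    #|layer (hm_family x H k) s.+1| + 'C(#|T| - k - 1, s).
Proof.
move=> xH cH sk.
pose P := [set S : {set T} | [&& S \subset [set: T], x \in S & #|S| == s.+1]].
pose Q := [set S : {set T} | [&& S \subset ~: H, x \in S & #|S| == s.+1]].
have cP : #|P| = 'C(#|T| - 1, s) by rewrite card_subsets_with ?inE // cardsT subn1.
have cQ : #|Q| = 'C(#|T| - k - 1, s).
  by rewrite card_subsets_with ?inE // cardsCs setCK cH subn1.
rewrite -cP -cQ.
have PQ : P :\: Q \subset layer (hm_family x H k) s.+1.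
  apply/subsetP => S; rewrite !inE subsetT /= => /andP[+ /andP[xS cS]].
  by rewrite xS cS !andbT (eqP cS) sk setI_eq0 disjoints_subset => ->.
case: (eqVneq s.+1 k) => [e|_]; last first.
  rewrite addn0 -(cardsID Q P) addnC leq_add //; last exact: subset_leq_card (subsetIr _ _).
  exact: subset_leq_card.
have HL : H \in layer (hm_family x H k) s.+1 by rewrite !inE eqxx orbT cH e eqxx.
have HPQ : H \notin P :\: Q by rewrite !inE (negPf xH) /= !andbF.
rewrite -(cardsID Q P) -addnA addnC leq_add //; last exact: subset_leq_card (subsetIr _ _).
have <- : #|H |: (P :\: Q)| = #|P :\: Q| + 1 by rewrite cardsU1 HPQ addnC.
by apply: subset_leq_card; rewrite subUset sub1set HL.
Qed.

(** One of [S] and [~: S] is in the family: the one containing [x] if it meets [H]; otherwise the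
    other contains [H] and has size at most [k], so it equals [H]. *)
Lemma hm_complementary_layers x H k s t : x \notin H -> #|H| = k ->
    s <= k -> t <= k -> s + t = #|T| ->
  'C(#|T|, s) <= #|layer (hm_family x H k) s| + #|layer (hm_family x H k) t|.
Proof.
move=> xH cH sk tk st.
rewrite -[X in 'C(X, _)]cardsT -cards_draws.
rewrite -[X in _ <= _ + X](card_imset _ (@setC_inj T)).
apply: leq_trans (leq_card_setU _ _).1; apply/subset_leq_card/subsetP => S.
rewrite !inE subsetT /= => /eqP cS.
have cCS : #|~: S| = t by have := cardsC S; move: st; rewrite cS; clear; lia.
have mem_im : (S \in [set ~: X | X in layer (hm_family x H k) t])
    = (~: S \in layer (hm_family x H k) t).
  apply/imsetP/idP => [[X XL ->]|h]; first by rewrite setCK.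
  by exists (~: S); rewrite ?setCK.
rewrite mem_im !inE cS cCS !eqxx !andbT sk tk /=.
case: (boolP (x \in S)) => /= xS.
  have [SH|//] := eqVneq (S :&: H) set0.
  have HS : H \subset ~: S by rewrite -disjoints_subset -setI_eq0 setIC SH.
  have : H == ~: S by rewrite eqEcard HS cCS cH.
  by rewrite eq_sym => ->; rewrite !orbT.
have [SH|] := eqVneq (~: S :&: H) set0; last by rewrite !orbT.
have HS : H \subset S by rewrite -[S]setCK -disjoints_subset -setI_eq0 setIC SH.
have : H == S by rewrite eqEcard HS cS cH.
by rewrite eq_sym => ->.
Qed.

(** * Layerwise and weighted comparison with the HM-family *)

Section Bound.
Variables (A : {set {set T}}) (k : nat) (x : T) (H : {set T}).
Hypotheses (iA : setfam_intersecting A) (ntA : setfam_nontrivial A).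
Hypotheses (kA : forall S, S \in A -> #|S| <= k).
Hypotheses (xH : x \notin H) (cH : #|H| = k).

Let f s := #|layer A s|.
Let h s := #|layer (hm_family x H k) s|.

Lemma layer_le_hm s : 2 * s <= #|T| -> f s <= h s.
Proof.
move=> s2; have [ks|sk] := ltnP k s.
  rewrite /f (_ : layer A s = set0) ?cards0 //; apply/setP => S; rewrite !inE.
  by apply/negP => /andP[/kA cS /eqP e]; move: cS; rewrite e leqNgt ks.
have hA S : S \in A -> (S \subset [set: T]) && (#|S| <= k).
  by move=> /kA ->; rewrite subsetT.
have := @layer_bound _ A [set: T] k s _ hA iA ntA sk.
rewrite cardsT => /(_ (hilton_milner _) s2); rewrite cardsT => /(_ s2).
case: s s2 sk => [|s] s2 sk lb.
  rewrite /f (_ : layer A 0 = set0) ?cards0 //; apply/setP => S; rewrite !inE.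
  apply/negP => /andP[SA]; rewrite cards_eq0 => /eqP S0.
  by have := iA SA SA; rewrite S0 setI0 eqxx.
have := hm_layer_ge xH cH sk; rewrite -/(h s.+1) -/(f s.+1) in lb *.
rewrite (_ : s.+1 - 1 = s) in lb; last by rewrite subn1.
by move: lb; clear; lia.
Qed.

Lemma complementary_layers_le_hm s t : s <= k -> t <= k -> s + t = #|T| ->
  f s + f t <= h s + h t.
Proof.
move=> sk tk st; apply: leq_trans (hm_complementary_layers xH cH sk tk st).
rewrite -[X in 'C(X, _)]cardsT; apply: (@card_complementary_layers _ _ _ _ s t).
- by rewrite cardsT.
- by move=> S; rewrite inE subsetT => /andP[].
- by move=> S; rewrite inE subsetT => /andP[].
by move=> S1 S2; rewrite !inE => /andP[S1A _] /andP[S2A _]; apply: iA.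
Qed.

Variable w : nat -> nat.
Hypotheses (w_big : forall t, k < t -> w t = 0).
Hypotheses (w_mono : forall s t, s <= t <= k -> s + t = #|T| -> w t <= w s).

(** For [s <= t <= k], write the pair as [f s * (w s - w t) + (f s + f t) * w t]; both coefficients
    of [f] are bounded by those of [h]. *)
Lemma weighted_pair_le s t : s + t = #|T| ->
  f s * w s + f t * w t <= h s * w s + h t * w t.
Proof.
wlog st : s t / s <= t.
  move=> hw e; have [|/ltnW] := leqP s t; first by move=> /hw; apply.
  by move=> /hw; rewrite addnC e => /(_ erefl); rewrite addnC [X in _ <= X]addnC.
move=> e; have fs : f s <= h s by apply: layer_le_hm; rewrite -e; move: st; clear; lia.
have [kt|tk] := ltnP k t; first by rewrite (w_big kt) !muln0 !addn0 leq_mul2r fs orbT.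
have ft : f s + f t <= h s + h t.
  by apply: complementary_layers_le_hm; rewrite // (leq_trans st).
have := w_mono (_ : s <= t <= k) e; rewrite st tk => /(_ isT) /subnKC <-.
move: fs ft; clear; move: (w s - w t) => d; nia.
Qed.

Lemma weighted_sum_le :
  \sum_(s < #|T|.+1) f s * w s <= \sum_(s < #|T|.+1) h s * w s.
Proof.
(* Doubling the sum and reversing one copy pairs [s] with [#|T| - s], a middle layer being paired
   with itself. *)
rewrite -(leq_pmul2l (isT : 0 < 2)) !mul2n -!addnn.
rewrite {2}(reindex_inj rev_ord_inj) [X in _ <= _ + X](reindex_inj rev_ord_inj) /=.
rewrite -!big_split /=; apply: leq_sum => s _; apply: weighted_pair_le.
by rewrite subSS subnKC // -ltnS.
Qed.

Lemma weighted_sum_tight s t : s + t = #|T| ->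
  \sum_(s < #|T|.+1) h s * w s <= \sum_(s < #|T|.+1) f s * w s ->
  h s * w s + h t * w t <= f s * w s + f t * w t.
Proof.
move=> st; rewrite -(leq_pmul2l (isT : 0 < 2)) !mul2n -!addnn.
rewrite {2}(reindex_inj rev_ord_inj) [X in _ <= _ + X](reindex_inj rev_ord_inj) /=.
rewrite -!big_split /= => hsum; rewrite leqNgt; apply/negP => lt_s.
have sT : s < #|T|.+1 by rewrite ltnS -st leq_addr.
move: hsum; rewrite leqNgt => /negP; apply.
rewrite (bigD1 (Ordinal sT)) //= [X in _ < X](bigD1 (Ordinal sT)) //= -addSn leq_add //.
  by rewrite subSS -st addKn.
by apply: leq_sum => i _; apply: weighted_pair_le; rewrite subSS subnKC // -ltnS.
Qed.

(** With the pair tight and [w t < w s], a deficit in layer [s] could not be made up by layer [t].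
    If [k < t], layer [t] has weight zero and [0 < w s] suffices. *)
Lemma weighted_layer_tight s t : s + t = #|T| -> s < t ->
    (if k < t then 0 < w s else w t < w s) ->
    \sum_(s < #|T|.+1) h s * w s <= \sum_(s < #|T|.+1) f s * w s ->
  h s <= f s.
Proof.
move=> st lt_st ws /(weighted_sum_tight st) hsum.
have [kt|tk] := ltnP k t.
  by move: ws hsum; rewrite kt (w_big kt) !muln0 !addn0 => ws; rewrite leq_pmul2r.
move: ws; rewrite ltnNge tk /= => ws.
have ft : f s + f t <= h s + h t.
  by apply: complementary_layers_le_hm; rewrite // (leq_trans (ltnW lt_st)).
rewrite leqNgt; apply/negP => fs; move: hsum; rewrite leqNgt => /negP; apply.
move: (subnKC ws) => <-; move: fs ft; clear; move: (w s - _) => d; nia.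
Qed.

End Bound.

(** The gap in Hilton-Milner makes the layer a star at some [x]. Extremality forces every member
    avoiding [x] to have size [k], and two such members would exclude more sets through [x] than the
    bound allows. *)
Lemma tight_layer_hm_family A k s : 3 < k -> 1 < s < k -> s + k <= #|T| -> 
    setfam_intersecting A -> setfam_nontrivial A ->
    (forall S, S \in A -> #|S| <= k) ->
    'C(#|T| - 1, s - 1) <= #|layer A s| + 'C(#|T| - k - 1, s - 1) ->
  exists x, exists2 G : {set T}, (x \notin G) && (#|G| == k) & A \subset hm_family x G k.
Proof.
case: s => // s k_gt3 /andP[s_gt0 sk] sn iA ntA kA.
rewrite (_ : s.+1 - 1 = s); last by rewrite subn1.
rewrite ltnS in s_gt0; move=> lb.
have iL := setfam_intersecting_sub (layer_sub A s.+1) iA.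
have hL S : S \in layer A s.+1 -> S \in A /\ #|S| == s.+1 by rewrite inE => /andP[].
have [ntL|[x hx]] := nontrivial_or_star (layer A s.+1).
  have hL' S : S \in layer A s.+1 -> (S \subset [set: T]) && (#|S| == s.+1).
    by move=> /hL[_ ->]; rewrite subsetT.
  have n2 : 2 * s.+1 <= #|[set: T]| by rewrite cardsT; move: sn sk; clear; lia.
  have := hilton_milner n2 hL' iL ntL; rewrite cardsT (_ : s.+1 - 1 = s) ?subn1 //.
  suff : 'C(#|T| - k - 1, s) + 1 < 'C(#|T| - s.+1 - 1, s).
    by rewrite -!subn1; move: lb; clear; lia.
  have -> : #|T| - s.+1 - 1 = (#|T| - s.+1 - 2).+1 by move: sn sk; clear; lia.
  have ineq : 'C(#|T| - k - 1, s) <= 'C(#|T| - s.+1 - 2, s).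
    by apply: leq_bin2l; move: sn sk; clear; lia.
  case: (s) s_gt0 sn sk ineq => [//|[|s']] _ sn sk ineq.
    (* The layer of size 2: the inequality reads [#|T| - k < #|T| - 3], whence [3 < k]. *)
    by rewrite !bin1; move: sn k_gt3; clear; lia.
  rewrite binS; suff : 1 < 'C(#|T| - s'.+3 - 2, s'.+1) by move: ineq; clear; lia.
  have := @ltn_bin2l s'.+1 (#|T| - s'.+3 - 2) s'.+1 isT; rewrite binn; apply.
    by move: sn sk; clear; lia.
  by move: sn sk; clear; lia.
have starP G (B : {set {set T}}) : G \in A -> x \notin G ->
    (forall S, S \in B -> [&& x \in S, #|S| == s.+1 & S :&: G != set0]) ->
    #|B| + 'C(#|T| - #|G| - 1, s) <= 'C(#|T| - 1, s).
  move=> GA xG hB; rewrite -cardsT; apply: (@star_bound _ _ _ G x); rewrite ?inE ?subsetT //.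
  by move=> S /hB /and3P[-> -> ->]; rewrite subsetT.
have hLG G : G \in A -> forall S, S \in layer A s.+1 -> [&& x \in S, #|S| == s.+1 & S :&: G != set0].
  by move=> GA S SL; rewrite hx //; have [SA ->] := hL _ SL; rewrite iA.
have cG G : G \in A -> x \notin G -> #|G| = k.
  move=> GA xG; apply/eqP; rewrite eqn_leq kA //= leqNgt; apply/negP => Gk.
  have lb' := starP _ _ GA xG (hLG _ GA).
  have := @ltn_bin2l (#|T| - k - 1) (#|T| - #|G| - 1) s s_gt0.
  by move: lb lb' sn Gk sk; clear; lia.
have [G GA xG] := ntA x; exists x, G; first by rewrite xG cG ?eqxx.
apply/subsetP => S SA; rewrite !inE.
case: (boolP (x \in S)) => xS; first by rewrite kA // iA.
rewrite andbF /=; rewrite eqEcard (cG _ SA) // (cG _ GA) // leqnn andbT.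
apply/negP => /negP /subsetPn[y yS yG].
have Gn : #|~: G| = #|T| - k by rewrite cardsCs setCK cG.
(* [D] misses [G], so it is not in the layer, yet it meets [S] at [y]. The layer enlarged by [D]
   violates [star_bound] for [S]. *)
have [D /andP[xyD DG] cD] : exists2 D : {set T}, ([set x; y] \subset D) && (D \subset ~: G) & #|D| = s.+1.
  apply: superset_of_size; first by rewrite subUset !sub1set !inE xG yG.
  by rewrite cards2 Gn; move: s_gt0 sn; case: (x != y); clear; lia.
have [xD yD] : x \in D /\ y \in D by move: xyD; rewrite subUset !sub1set => /andP[].
have DL : D \notin layer A s.+1.
  apply/negP => /hL[DA _]; have := iA _ _ DA GA.
  by rewrite setI_eq0 disjoints_subset DG.
have := starP S (D |: layer A s.+1) SA xS; rewrite (cG _ SA) // cardsU1 DL.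
have hD S' : S' \in D |: layer A s.+1 -> [&& x \in S', #|S'| == s.+1 & S' :&: S != set0].
  rewrite in_setU1 => /orP[/eqP ->|/(hLG _ SA)//].
  by rewrite xD cD eqxx; apply/set0Pn; exists y; rewrite inE yD.
by move=> /(_ hD); move: lb; clear; lia.
Qed.

End WeightedHiltonMilner.

(** * Counting compositions by their block starts *)

Lemma leq_card_by_degree (I J : finType) (L : {set I}) (R : {set J})
    (e : I -> J -> bool) (d : nat) :
    0 < d ->
    (forall a, a \in L -> d <= #|[set b in R | e a b]|) ->
    (forall b, b \in R -> #|[set a in L | e a b]| <= d) ->
  #|L| <= #|R|.
Proof.
move=> d_gt0 hL hR; rewrite -(leq_pmul2r d_gt0).
have -> : #|L| * d = \sum_(a in L) d by rewrite sum_nat_const.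
apply: leq_trans (leq_sum _ hL) _.
rewrite (eq_bigr (fun a => \sum_(b in R | e a b) 1)); last first.
  by move=> a _; rewrite -sum1_card; apply: eq_bigl => b; rewrite inE.
rewrite (exchange_big_dep (mem R)) /=; last by move=> a b _ /andP[].
rewrite -sum_nat_const; apply: leq_sum => b bR.
apply: leq_trans (hR _ bR); rewrite -sum1_card.
by rewrite leq_eqVlt; apply/orP; left; apply/eqP/eq_bigl => a; rewrite !inE bR.
Qed.

Section BlockStarts.
Variables (k m : nat).
Implicit Types (C K X B : {set 'I_k.+1}).

(* The positions at which the blocks of a composition of k.+1 with parts at
   most m start. *)
Definition block_starts C : bool :=
  (ord0 \in C) && [forall i : 'I_k.+1, (i + m <= k.+1) ==>
    [exists j in C, i <= j < i + m]].

Definition starts_of_card t := [set C | block_starts C & #|C| == t].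

Lemma block_startsP C :
  reflect (ord0 \in C /\ forall i, i + m <= k.+1 -> exists2 j, j \in C & i <= j < i + m)
    (block_starts C).
Proof.
apply: (iffP andP) => -[C0 hC]; split=> //.
  move=> i im; have [m0|m_gt0] := posnP m.
    have := forallP hC ord0; rewrite m0 leq0n /= => /exists_inP[j _].
    by rewrite ltn0.
  have ik : i < k.+1 by lia.
  by have := forallP hC (Ordinal ik); rewrite /= im => /exists_inP[j jC hj]; exists j.
apply/forallP => i; apply/implyP => im; have [j jC hj] := hC _ im.
by apply/exists_inP; exists j.
Qed.

Lemma block_starts_superset C K : K \subset C -> block_starts K -> block_starts C.
Proof.
move=> /subsetP KC /block_startsP[K0 hK]; apply/block_startsP; split; first exact: KC.
by move=> i im; have [j /KC jC hj] := hK _ im; exists j.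
Qed.

Definition multiples := [set i : 'I_k.+1 | (0 < i) && (m %| i)].

(* Besides 0 and the multiples of m in C, it is enough to keep the elements of
   C adjacent to each multiple of m outside C, since every window of length m
   contains a multiple of m. *)
Lemma block_starts_core C : 0 < m -> block_starts C ->
  exists K, [/\ K \subset C, block_starts K, C :&: multiples \subset K &
    #|K| <= #|multiples|.+1 + #|multiples :\: C|].
Proof.
move=> m_gt0 /block_startsP[C0 hC]; set B := multiples.
pose pr (b : 'I_k.+1) := [arg max_(j > ord0 | (j \in C) && (j <= b)) (j : nat)].
(* [su b] is the next element of [C] after [b]; if there is none it defaults to [ord0], which [F]
   ranks last. *)
pose F (j : 'I_k.+1) := if j == ord0 then k.+1 else j.
pose su (b : 'I_k.+1) := [arg min_(j < ord0 | (j \in C) && ((b < j) || (j == ord0))) F j].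
pose K := ord0 |: (C :&: B) :|: (pr @: (B :\: C) :|: su @: (B :\: C)).
have prP (b : 'I_k.+1) : [/\ pr b \in C, pr b <= b & forall j, j \in C -> j <= b -> j <= pr b].
  rewrite /pr; case: arg_maxnP => [|i /andP[iC ib] hi]; first by rewrite C0.
  by split=> // j jC jb; apply: hi; rewrite jC.
have suC (b : 'I_k.+1) : su b \in C.
  by rewrite /su; case: arg_minnP => [|i /andP[]]; rewrite // C0 eqxx orbT.
have suP (b j : 'I_k.+1) : j \in C -> b < j -> b < su b <= j.
  move=> jC bj; rewrite /su; case: arg_minnP => [|i /andP[iC hi] mi].
    by rewrite C0 eqxx orbT.
  have := mi j; rewrite jC bj /= => /(_ isT); rewrite /F.
  have -> : j == ord0 = false by apply/negP => /eqP j0; rewrite j0 in bj.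
  move: hi; have [_ _|_] := eqVneq i ord0; first by have := ltn_ord j; lia.
  by rewrite orbF => -> ->.
exists K; split.
- apply/subsetP => j; rewrite !inE => /orP[/orP[/eqP -> //|/andP[]//]|].
  by case/orP => /imsetP[b _ ->] //; have [] := prP b.
- apply/block_startsP; split; first by rewrite !inE eqxx.
  move=> i im; have [j jC /andP[ij ji]] := hC _ im.
  (* The multiple of [m] in the window. If it is not in [C], a start [j] of [C] in the window lies
     on one side of it, and the neighbour of [b] on that side lies between them. *)
  pose b := (i + m.-1) %/ m * m.
  have ib : i <= b < i + m.
    by have := divn_eq (i + m.-1) m; have := ltn_pmod (i + m.-1) m_gt0; rewrite -/b; lia.
  have bk : b < k.+1 by lia.
  have [b0|b_gt0] := posnP b.
    by exists ord0; rewrite ?inE ?eqxx //=; move: ib; rewrite b0; lia.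
  have bB : Ordinal bk \in B by rewrite inE /= b_gt0 dvdn_mull.
  case: (boolP (Ordinal bk \in C)) => [bC|bC].
    by exists (Ordinal bk); rewrite // inE [in X in X || _]inE in_setI bC bB orbT.
  have bBC : Ordinal bk \in B :\: C by rewrite inE bC.
  case: (leqP j b) => jb.
    have [_ /= p1 p2] := prP (Ordinal bk); have {}p2 := p2 j jC jb.
    exists (pr (Ordinal bk)); first by rewrite !in_setU imset_f // !orbT.
    move: p1 p2 ij ib; clear; lia.
  have /andP[/= s1 s2] := suP (Ordinal bk) j jC jb.
  exists (su (Ordinal bk)); first by rewrite !in_setU imset_f // !orbT.
  move: s1 s2 ji ib; clear; lia.
- by apply/subsetP => j jCB; rewrite !in_setU jCB orbT.
have h1 := (leq_card_setU (ord0 |: (C :&: B)) (pr @: (B :\: C) :|: su @: (B :\: C))).1.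
have h2 := (leq_card_setU (pr @: (B :\: C)) (su @: (B :\: C))).1.
have h3 := (leq_card_setU [set ord0] (C :&: B)).1.
have h4 : #|pr @: (B :\: C)| <= #|B :\: C| := leq_imset_card _ _.
have h5 : #|su @: (B :\: C)| <= #|B :\: C| := leq_imset_card _ _.
have h6 := cardsID C B; rewrite setIC in h6.
rewrite cards1 in h3.
apply: leq_trans h1 _; apply: leq_trans (leq_add h3 (leq_trans h2 (leq_add h4 h5))) _.
by rewrite -h6 -addSn add1n addnA.
Qed.

(** Within the class of trace [X], let [c] be the number of multiples outside [X]. From [C] one may
    delete any [t - s] elements outside its core, at least [k.+1 - s - c] being available; to [C']
    one may add only elements outside [C'] and the multiples, of which there are exactly that
    many. *)
Theorem starts_of_card_mono s t : 0 < m ->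
  s <= t -> t <= k.+1 -> k.+1 + #|multiples|.+1 <= s + t ->
  #|starts_of_card t| <= #|starts_of_card s|.
Proof.
move=> m_gt0 st tk kst; set B := multiples.
pose cls u X := [set C in starts_of_card u | C :&: B == X].
have splitc u : #|starts_of_card u| = \sum_(X : {set 'I_k.+1}) #|cls u X|.
  rewrite -sum1_card (partition_big (fun C => C :&: B) predT) //=.
  by apply: eq_bigr => X _; rewrite -sum1_card; apply: eq_bigl => C; rewrite !inE.
rewrite !splitc; apply: leq_sum => X _.
have [->|/set0Pn[C0]] := eqVneq (cls t X) set0; first by rewrite cards0.
rewrite !inE -andbA => /and3P[_ /eqP C0t /eqP C0X].
pose c := #|B :\: X|.
have Bdiff C : C :&: B = X -> B :\: C = B :\: X.
  by move=> <-; rewrite setDIr setDv setU0.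
have ck : c + t <= k.+1.
  rewrite -C0t /c -(Bdiff _ C0X); rewrite -[X in _ <= X]card_ord -(cardsC C0) addnC leq_add2l.
  by apply/subset_leq_card; rewrite setDE subsetIr.
apply: (@leq_card_by_degree _ _ _ _ (fun C C' => C' \subset C) 'C(k.+1 - s - c, t - s)).
- rewrite bin_gt0; move: ck st; clear; lia.
- move=> C; rewrite !inE -andbA => /and3P[sC /eqP Ct /eqP CX].
  have [K [KC sK BK cK]] := block_starts_core m_gt0 sC.
  have inj : {in [set D : {set 'I_k.+1} | D \subset C :\: K & #|D| == t - s] &,
     injective (fun D => C :\: D)}.
    move=> D1 D2; rewrite !inE => /andP[/subsetDP[s1 _] _] /andP[/subsetDP[s2 _] _] e.
    by rewrite -(setIidPr s1) -(setIidPr s2) -(set0U (_ :&: D1)) -(set0U (_ :&: D2))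
      -(setDv C) -!setDDr e.
  apply: (@leq_trans 'C(#|C :\: K|, t - s)).
    apply: leq_bin2l; rewrite cardsDS // Ct; move: cK kst; rewrite -/B (Bdiff _ CX) -/c.
    clear; lia.
  rewrite -cards_draws -(card_in_imset inj); apply/subset_leq_card/subsetP.
  move=> _ /imsetP[D + ->]; rewrite !inE => /andP[/subsetDP[DC dDK] /eqP cD].
  have KD : K \subset C :\: D by apply/subsetDP; split; rewrite // disjoint_sym.
  rewrite (block_starts_superset KD sK) subsetDl /= andbT cardsDS // Ct cD subKn // eqxx /=.
  apply/eqP/setP => j; rewrite -CX !in_setI in_setD.
  case jC: (j \in C); rewrite ?andbF //= andbT; case jB: (j \in B); rewrite ?andbF ?andbT //.
  apply/negP => jD; move/subsetP: BK => /(_ j); rewrite in_setI jC jB => /(_ isT) jK.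
  by have := disjointFr dDK jD; rewrite jK.
move=> C'; rewrite !inE -andbA => /and3P[_ /eqP C's /eqP C'X].
have inj : {in [set C in cls t X | C' \subset C] &, injective (fun C => C :\: C')}.
  move=> C1 C2; rewrite !inE => /andP[_ s1] /andP[_ s2] e.
  by rewrite -(setID C1 C') -(setID C2 C') (setIidPr s1) (setIidPr s2) e.
rewrite -(card_in_imset inj).
have -> : k.+1 - s - c = #|~: (C' :|: B)|.
  rewrite /c -(Bdiff _ C'X).
  rewrite -subnDA -C's -[X in X - _](card_ord k.+1) -(cardsC (C' :|: B)).
  rewrite (_ : #|C' :|: B| = #|C'| + #|B :\: C'|) ?addKn //.
  by rewrite -(cardsID C' (C' :|: B)) setUK setDUl setDv set0U.
rewrite -cards_draws; apply/subset_leq_card/subsetP => _ /imsetP[C + ->].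
rewrite in_set => /andP[CtX C'C].
have [/eqP Ct /eqP CX] : #|C| == t /\ C :&: B == X.
  by move: CtX; rewrite !in_set => /andP[/andP[_ ->] ->].
rewrite inE.
rewrite cardsDS // Ct C's eqxx andbT; apply/subsetP => j; rewrite in_setC in_setU in_setD negb_or.
move=> /andP[jC' jC]; rewrite jC' /=; apply: contra jC' => jB.
by have : j \in C :&: B; [rewrite in_setI jC | rewrite CX -C'X in_setI => /andP[]].
Qed.

End BlockStarts.

(** * Multisets with a given support *)

Local Open Scope fset_scope.
Local Open Scope mset_scope.
Local Open Scope nat_scope.

Lemma leq_card_fset_set (K : choiceType) (J : finType) (X : {fset K})
    (D : {set J}) (f : K -> J) :
  {in X &, injective f} -> {in X, forall x, f x \in D} -> #|` X| <= #|D|.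
Proof.
move=> inj fD; rewrite cardE -(size_map f X); apply: uniq_leq_size.
  by rewrite map_inj_in_uniq.
by move=> _ /mapP[x xX ->]; rewrite mem_enum; apply: fD.
Qed.

Lemma leq_card_set_fset (K : choiceType) (J : finType) (X : {fset K})
    (D : {set J}) (f : J -> K) :
  {in D &, injective f} -> {in D, forall x, f x \in X} -> #|D| <= #|` X|.
Proof.
move=> inj fX; rewrite cardE -(size_map f (enum D)); apply: uniq_leq_size.
  by rewrite map_inj_in_uniq ?enum_uniq // => x y; rewrite !mem_enum; apply: inj.
by move=> _ /mapP[x xD ->]; apply: fX; rewrite -mem_enum.
Qed.

Lemma card_ord_ltn N i : i <= N -> #|[set j : 'I_N | j < i]| = i.
Proof.
move=> iN; rewrite -sum1_card (eq_bigl (fun j : 'I_N => j < i)); last first.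
  by move=> j; rewrite inE.
by rewrite -(big_ord_widen _ (fun=> 1) iN) sum1_card card_ord.
Qed.

(** Two down-closed predicates with equal counts therefore coincide. *)
Lemma initial_segment_card N (P : pred 'I_N) :
  (forall i j : 'I_N, i <= j -> P j -> P i) ->
  forall j : 'I_N, P j = (j < #|[set i | P i]|).
Proof.
move=> hP j; apply/idP/idP => [Pj|].
  rewrite -[X in X <= _](card_ord_ltn (ltn_ord j)).
  by apply/subset_leq_card/subsetP => i; rewrite !inE ltnS => /hP; apply.
apply: contraTT => nPj; rewrite -leqNgt -[X in _ <= X](card_ord_ltn (ltnW (ltn_ord j))).
apply/subset_leq_card/subsetP => i; rewrite !inE ltnNge => Pi.
by apply: contraNN nPj => /hP; apply.
Qed.

Lemma le_ceil_div_mul k m : 0 < min_inf k m -> k <= ceil_div k m * min_inf k m.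
Proof.
case: m => [b|] /=; last by rewrite mul1n.
rewrite leq_min => /andP[k_gt0 b_gt0]; rewrite -[(k + b - 1) %/ b]/(ceil_div k (Some b)).
have [kb|bk] := leqP k b; last by rewrite -ceil_div_le.
rewrite leq_pmull // lt0n; apply/negP => /eqP c0.
by have := ceil_div_le k 0 b_gt0; rewrite c0 mul0n [k <= 0]leqNgt k_gt0.
Qed.

(** * Positions in a set of ordinals *)

Section Rank.
Variable N : nat.
Implicit Types (S : {set 'I_N}) (x y : 'I_N).

(** On [S] this is the position counted from 1; for a set of block starts it is the number of the
    block containing [x]. *)
Definition rank S x := #|[set y in S | y <= x]|.

Lemma rank_mono S x y : x <= y -> rank S x <= rank S y.
Proof.
move=> xy; apply/subset_leq_card/subsetP => z; rewrite !inE => /andP[-> zx].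
exact: leq_trans xy.
Qed.

Lemma rank_lt S x y : y \in S -> x < y -> rank S x < rank S y.
Proof.
move=> yS xy; apply: proper_card; apply/properP; split.
  apply/subsetP => z; rewrite !inE => /andP[-> zx]; exact: leq_trans (ltnW xy).
by exists y; rewrite !inE yS ?leqnn // -ltnNge.
Qed.

Lemma rank_inj S : {in S &, injective (rank S)}.
Proof.
move=> x y xS yS e; apply: val_inj; case: (ltngtP x y) => // h.
  by have := rank_lt yS h; rewrite e ltnn.
by have := rank_lt xS h; rewrite e ltnn.
Qed.

Lemma rank_le_card S x : rank S x <= #|S|.
Proof. by apply/subset_leq_card/subsetP => z; rewrite inE => /andP[]. Qed.

Lemma rank_gt0 S x : x \in S -> 0 < rank S x.
Proof. by move=> xS; rewrite card_gt0; apply/set0Pn; exists x; rewrite inE xS /=. Qed.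

Lemma rank_onto S v : 0 < v <= #|S| -> exists2 x, x \in S & rank S x = v.
Proof.
move=> hv; have sz : size (iota 1 #|S|) <= size [seq rank S x | x <- enum S].
  by rewrite size_map size_iota -cardE.
have un : uniq [seq rank S x | x <- enum S].
  by rewrite map_inj_in_uniq ?enum_uniq // => x y; rewrite !mem_enum; apply: rank_inj.
have sb : {subset [seq rank S x | x <- enum S] <= iota 1 #|S|}.
  move=> _ /mapP[x xS ->]; rewrite mem_enum in xS.
  by rewrite mem_iota rank_gt0 // add1n ltnS rank_le_card.
have [_ e] := uniq_min_size un sb sz.
have : v \in iota 1 #|S| by rewrite mem_iota add1n ltnS.
by rewrite -e => /mapP[x xS ->]; exists x; rewrite // -mem_enum.
Qed.

End Rank.

(** * Multisets on a fixed support as compositions *)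

Section MultisetsOnSupport.
Variables (n k : nat) (m : option nat).
Implicit Types (A : {mset 'I_n}) (S T : {set 'I_n}) (x y : 'I_n).

Definition supp A : {set 'I_n} := [set x | 0 < A x].

Definition msets_on S : {fset {mset 'I_n}} :=
  [fset A in ksubsets m n k.+1 | supp A == S].

(** A multiplicity never exceeds the cardinality, so the possibly infinite cap becomes a finite
    one. *)
Lemma in_msets_on S A : A \in msets_on S ->
  [/\ supp A = S, card_mset A = k.+1 & forall x, A x <= min_inf k.+1 m].
Proof.
rewrite in_fset /= inE in_ksubsets => /andP[/andP[/eqP cA /forallP hA] /eqP sA].
split=> // x; have := hA x.
have : A x <= k.+1 by rewrite -cA /card_mset (bigD1 x) //= leq_addr.
by case: (m) => [b|] //=; rewrite leq_min => -> ->.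
Qed.

Lemma msets_onP S A : supp A = S -> card_mset A = k.+1 ->
  (forall x, A x <= min_inf k.+1 m) -> A \in msets_on S.
Proof.
move=> sA cA hA; rewrite in_fset /= inE in_ksubsets cA sA !eqxx andbT /=.
by apply/forallP => x; have := hA x; case: (m) => [b|] //=; rewrite leq_min => /andP[].
Qed.

Definition mset_of (f : 'I_n -> nat) : {mset 'I_n} :=
  [fsfun x in [fset x in enum 'I_n] => f x].

Lemma mset_ofE f x : mset_of f x = f x.
Proof. by rewrite fsfunE !inE mem_enum. Qed.

Definition prefix A (i : nat) := \sum_(y < n | y < i) A y.

Lemma prefix_mono A i j : i <= j -> prefix A i <= prefix A j.
Proof.
move=> ij; rewrite /prefix [X in _ <= X](bigID (fun y : 'I_n => y < i)) /=.
rewrite (eq_bigl (fun y : 'I_n => (y < j) && (y < i))) ?leq_addr // => y.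
by rewrite andb_idl // => /leq_trans; apply.
Qed.

Lemma prefixS A x : prefix A x.+1 = prefix A x + A x.
Proof.
rewrite /prefix (bigD1 x) ?ltnSn //= addnC; congr (_ + _).
by apply: eq_bigl => y; rewrite ltnS [X in _ = X]ltn_neqAle andbC.
Qed.

Lemma prefix_all A : prefix A n = card_mset A.
Proof. by apply: eq_bigl => y; rewrite ltn_ord. Qed.

Lemma prefix_next A i : prefix A i < card_mset A ->
  exists y, [/\ 0 < A y, i <= y & prefix A y = prefix A i].
Proof.
have [d] : exists d, n - i <= d by eexists.
elim: d i => [|d IHd] i hd hi.
  have := @prefix_mono A n i; rewrite prefix_all; lia.
have [ni|lt_in] := leqP n i; first by have := prefix_mono A ni; rewrite prefix_all; lia.
have := prefixS A (Ordinal lt_in); have [A0|A_gt0] := posnP (A (Ordinal lt_in)).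
  rewrite A0 addn0 /= => e; have [| |y [Ay iy ey]] := IHd i.+1; rewrite ?e //; first lia.
  by exists y; split; rewrite ?ey ?e ?(ltnW iy).
by exists (Ordinal lt_in).
Qed.

Lemma prefix_lt A x : 0 < A x -> prefix A x < card_mset A.
Proof.
move=> Ax; rewrite -prefix_all; apply: leq_trans (prefix_mono A (ltn_ord x)).
by rewrite prefixS -addn1 leq_add2l.
Qed.

Lemma prefix_supp_lt A x y : 0 < A x -> x < y -> prefix A x < prefix A y.
Proof.
move=> Ax xy; apply: leq_trans (prefix_mono A xy).
by rewrite prefixS -addn1 leq_add2l.
Qed.

(** With the copies laid out in increasing order on positions 0 to [k], those of [x] form a block
    starting at [prefix A x]. *)
Definition start_set A : {set 'I_k.+1} :=
  (fun x => inord (prefix A x)) @: supp A.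

Lemma start_set_val A x : card_mset A = k.+1 -> 0 < A x ->
  val (inord (prefix A x) : 'I_k.+1) = prefix A x.
Proof. by move=> cA Ax; rewrite /= inordK // -cA prefix_lt. Qed.

Lemma start_inj A : card_mset A = k.+1 ->
  {in supp A &, injective (fun x => inord (prefix A x) : 'I_k.+1)}.
Proof.
move=> cA x y; rewrite !inE => Ax Ay /(congr1 val).
rewrite !start_set_val // => e; apply: val_inj; case: (ltngtP x y) => // h.
  by have := prefix_supp_lt Ax h; rewrite e ltnn.
by have := prefix_supp_lt Ay h; rewrite e ltnn.
Qed.

Lemma start_setP S A : 0 < min_inf k.+1 m -> A \in msets_on S ->
  start_set A \in starts_of_card k (min_inf k.+1 m) #|S|.
Proof.
move=> m_gt0 /in_msets_on[<- cA hA]; rewrite inE (card_in_imset (start_inj cA)) eqxx andbT.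
have p0 : prefix A 0 = 0 by rewrite /prefix big_pred0.
apply/block_startsP; split.
  have [|y [Ay _ ey]] := @prefix_next A 0; first by rewrite p0 cA.
  apply/imsetP; exists y; first by rewrite inE.
  by apply: val_inj; rewrite start_set_val // ey p0.
move=> i im.
have [|x0 [Ax0 _ e0]] := @prefix_next A 0; first by rewrite p0 cA.
(* [x] carries the last block starting at or before [i]. Unless it starts at [i], the next block
   starts after [i] and within the window, as the block of [x] is short. *)
case: (@arg_maxnP _ x0 (fun x => (0 < A x) && (prefix A x <= i)) (prefix A)).
  by rewrite Ax0 e0 p0.
move=> x /andP[Ax xi] mx.
have [e|lt_xi] := eqVneq (prefix A x) i.
  exists (inord (prefix A x)); first by apply: imset_f; rewrite inE.
  by rewrite start_set_val // e leqnn -[X in X < _]addn0 ltn_add2l.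
have {}lt_xi : prefix A x < i by rewrite ltn_neqAle lt_xi.
have nx : prefix A x.+1 < i + min_inf k.+1 m.
  by rewrite prefixS -addSn leq_add.
have [|y [Ay _ ey]] := @prefix_next A x.+1; first by rewrite cA; apply: leq_trans im.
exists (inord (prefix A y)); first by apply: imset_f; rewrite inE.
rewrite start_set_val // ey nx andbT leqNgt; apply/negP => lt_i.
have := mx y; rewrite Ay ey (ltnW lt_i) => /(_ isT).
by rewrite prefixS /geq /= -[X in _ <= X]addn0 leq_add2l leqNgt Ax.
Qed.

(** The number of starts below [prefix A x] is the number of elements of [S] below [x], whatever [A]
    is. So the starts determine the prefixes on [S], then everywhere by [prefix_next]. *)
Lemma start_set_inj S : {in msets_on S &, injective start_set}.
Proof.
suff le_prefix A A' : A \in msets_on S -> A' \in msets_on S ->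
    start_set A = start_set A' -> forall x, x \in S -> prefix A x <= prefix A' x.
  move=> A A' AS A'S e; have [sA cA _] := in_msets_on AS; have [sA' cA' _] := in_msets_on A'S.
  have eS x : x \in S -> prefix A x = prefix A' x.
    by move=> xS; apply/eqP; rewrite eqn_leq !le_prefix.
  have {}eS i : i <= n -> prefix A i = prefix A' i.
    suff le_all B B' : supp B = S -> supp B' = S -> card_mset B = k.+1 ->
        card_mset B' = k.+1 -> (forall x, x \in S -> prefix B x = prefix B' x) ->
        i <= n -> prefix B' i <= prefix B i.
      by move=> i_n; apply/eqP; rewrite eqn_leq !le_all // => x xS; rewrite eS.
    move=> sB sB' cB cB' eB i_n.
    have [lt_i|] := ltnP (prefix B i) k.+1; last first.
      by rewrite -{1}cB' -prefix_all; apply: leq_trans; apply: prefix_mono.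
    have [|y [By iy ey]] := @prefix_next B i; first by rewrite cB.
    by rewrite -ey eB ?prefix_mono // -sB inE.
  apply/msetP => x; apply: (@addnI (prefix A' x)).
  by rewrite -prefixS -(eS x) ?(ltnW (ltn_ord x)) // -prefixS eS.
move=> /in_msets_on[sA cA _] /in_msets_on[sA' cA' _] e x xS.
pose below (N : nat) := [set j in start_set A | j < N].
have card_below B : supp B = S -> card_mset B = k.+1 -> start_set B = start_set A ->
    #|below (prefix B x)| = #|[set y in S | y < x]|.
  move=> sB cB eB.
  have inj := start_inj cB; rewrite sB in inj.
  have -> : below (prefix B x) = (fun x => inord (prefix B x)) @: [set y in S | y < x].
    rewrite /below -eB; apply/setP => j; rewrite in_set; apply/andP/imsetP.
      case=> /imsetP[y yS ->]; have By : 0 < B y by rewrite inE in yS.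
      rewrite start_set_val // => lt_y; exists y => //; rewrite inE -sB yS /=.
      by rewrite ltnNge; apply: contraL lt_y => xy; rewrite -leqNgt prefix_mono.
    case=> y; rewrite inE => /andP[yS yx] ->; rewrite -sB in yS.
    have By : 0 < B y by rewrite inE in yS.
    by split; [apply: imset_f|rewrite start_set_val // prefix_supp_lt].
  apply: card_in_imset => y z; rewrite !inE => /andP[yS _] /andP[zS _].
  exact: inj.
have cb := card_below A sA cA erefl; have cb' := card_below A' sA' cA' (esym e).
rewrite leqNgt; apply/negP => lt_p.
have Ax : 0 < A' x by move: xS; rewrite -sA' inE.
have : #|below (prefix A' x)| < #|below (prefix A x)|.
  apply: proper_card; apply/properP; split.
    apply/subsetP => j; rewrite !in_set => /andP[-> /=]; move/ltn_trans; exact.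
  exists (inord (prefix A' x)); rewrite !in_set !start_set_val // ?lt_p ?ltnn ?andbF //.
  by rewrite andbT e; apply: imset_f; rewrite inE.
by rewrite cb cb' ltnn.
Qed.

(** The element of rank [r] in [S] receives the length of the block number [r]. *)
Definition mset_of_starts S (C : {set 'I_k.+1}) : {mset 'I_n} :=
  mset_of (fun x => if x \in S then #|[set j | rank C j == rank S x]| else 0).

Lemma mset_of_startsP S C : 0 < min_inf k.+1 m ->
  C \in starts_of_card k (min_inf k.+1 m) #|S| -> mset_of_starts S C \in msets_on S.
Proof.
move=> m_gt0; rewrite inE => /andP[/block_startsP[C0 hC] /eqP cC].
have rgt0 j : 0 < rank C j.
  by apply: leq_trans (rank_gt0 C0) _; apply: rank_mono.
apply: msets_onP.
- apply/setP => x; rewrite inE mset_ofE; case: ifP => // xS.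
  have [|j jC ej] := @rank_onto _ C (rank S x); first by rewrite rank_gt0 // cC rank_le_card.
  by rewrite card_gt0; apply/set0Pn; exists j; rewrite inE ej.
- rewrite /card_mset; under eq_bigr do rewrite mset_ofE -sum1_card big_mkcond /=.
  rewrite -big_mkcond /=.
  under eq_bigr => x _ do under eq_bigr => j _ do rewrite inE.
  (* Each position lies in one block, which belongs to exactly one element of [S]. *)
  rewrite exchange_big /= -[RHS](card_ord k.+1) -sum1_card; apply: eq_bigr => j _.
  have [|x xS ex] := @rank_onto _ S (rank C j); first by rewrite rgt0 -cC rank_le_card.
  rewrite (bigD1 x) //= ex eqxx big1 // => y /andP[yS yx]; case: eqP => // e.
  by rewrite (rank_inj yS xS) ?eqxx // in yx; rewrite -e ex.
- move=> x; rewrite mset_ofE; case: ifP => // xS; set L := [set j | _].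
  have [->|/set0Pn[j0 j0L]] := eqVneq L set0; first by rewrite cards0.
  case: (@arg_minnP _ j0 (fun j => j \in L) val) => // p pL minp.
  rewrite cardE -(size_map val) -[X in _ <= X](size_iota p); apply: uniq_leq_size.
    by rewrite map_inj_uniq ?enum_uniq //; apply: val_inj.
  move=> _ /mapP[j + ->]; rewrite mem_enum mem_iota => jL; rewrite minp //=.
  (* [p] is the first position of the block. If the block were longer than the cap, the window
     opening at [p.+1] would hold a start [c <= j], raising the rank. *)
  rewrite ltnNge; apply/negP => pj.
  have [|c cinC /andP[pc cj]] := hC p.+1; first by have := ltn_ord j; rewrite addSn; apply: leq_trans.
  have := rank_lt cinC pc; have : rank C c <= rank C j.
    by apply: rank_mono; apply: leq_trans pj; rewrite -ltnS -addSn.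
  move: pL jL; rewrite !inE => /eqP -> /eqP ->; clear; lia.
Qed.

(** Partial sums of the multiplicities count the positions of rank at most [v]. These form initial
    segments, so the multiset determines all ranks, and the starts are the positions where the rank
    jumps. *)
Lemma mset_of_starts_inj S :
  {in starts_of_card k (min_inf k.+1 m) #|S| &, injective (mset_of_starts S)}.
Proof.
move=> C C'; rewrite !inE => /andP[/andP[C0 _] /eqP cC] /andP[/andP[C'0 _] /eqP cC'] e.
have rgt0 (D : {set 'I_k.+1}) j : ord0 \in D -> 0 < rank D j.
  by move=> D0; apply: leq_trans (rank_gt0 D0) _; apply: rank_mono.
have cumul (D : {set 'I_k.+1}) v : ord0 \in D -> #|D| = #|S| ->
    #|[set j | rank D j <= v]| = \sum_(x in S | rank S x <= v) mset_of_starts S D x.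
  move=> D0 cD; under eq_bigr => x /andP[xS _] do rewrite mset_ofE xS -sum1_card big_mkcond.
  rewrite exchange_big /= -sum1_card big_mkcond; apply: eq_bigr => j _; rewrite inE.
  have [|x xS ex] := @rank_onto _ S (rank D j); first by rewrite rgt0 // -cD rank_le_card.
  case: ifP => hv; last first.
    by rewrite big1 // => y /andP[yS yv]; rewrite inE; case: eqP => // ey; rewrite ey yv in hv.
  rewrite (bigD1 x) /=; last by rewrite xS ex.
  rewrite inE ex eqxx big1 // => y /andP[/andP[yS _] yx].
  rewrite inE; case: eqP => // ey.
  by rewrite (rank_inj yS xS) ?eqxx // in yx; rewrite -ey ex.
have rle v j : (rank C j <= v) = (rank C' j <= v).
  have dn (D : {set 'I_k.+1}) : forall i j : 'I_k.+1, i <= j -> rank D j <= v -> rank D i <= v.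
    by move=> i j' ij; apply: leq_trans; apply: rank_mono.
  rewrite (initial_segment_card (dn C)) (initial_segment_card (dn C')) !cumul //.
  by under eq_bigr do rewrite e.
have req j : rank C j = rank C' j by apply/eqP; rewrite eqn_leq rle leqnn -rle leqnn.
have inD (D : {set 'I_k.+1}) j : ord0 \in D ->
    (j \in D) = [forall i : 'I_k.+1, (i < j) ==> (rank D i < rank D j)].
  move=> D0; apply/idP/forallP => [jD i|h]; first by apply/implyP; apply: rank_lt.
  have [->//|j0] := eqVneq j ord0.
  have j_gt0 : 0 < j by rewrite lt0n; apply: contraNneq j0 => j0; apply/eqP/val_inj.
  have ij : j.-1 < k.+1 by apply: leq_ltn_trans (ltn_ord j); apply: leq_pred.
  have := h (Ordinal ij); rewrite /= prednK // leqnn /=; apply: contraTT => jD.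
  rewrite -leqNgt; apply/subset_leq_card/subsetP => z; rewrite !inE => /andP[zD zj].
  rewrite zD /= -ltnS prednK // ltn_neqAle zj andbT; apply: contraNneq jD => zj'.
  by rewrite -(val_inj zj').
apply/setP => j; rewrite (inD C) // (inD C') //.
by apply: eq_forallb => i; rewrite !req.
Qed.

Lemma card_msets_on S : 0 < min_inf k.+1 m ->
  #|` msets_on S| = #|starts_of_card k (min_inf k.+1 m) #|S| |.
Proof.
move=> m_gt0; apply/eqP; rewrite eqn_leq; apply/andP; split.
  by apply: leq_card_fset_set (@start_set_inj S) _ => A; apply: start_setP.
by apply: leq_card_set_fset (@mset_of_starts_inj S) _ => C; apply: mset_of_startsP.
Qed.

(** Division by the cap maps these multiples injectively into 1, ..., q - 1, with q the ceiling.
    This turns a bound by q into the hypothesis of [starts_of_card_mono]. *)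
Lemma card_multiples : 0 < min_inf k.+1 m ->
  (#|multiples k (min_inf k.+1 m)|).+1 <= ceil_div k.+1 m.
Proof.
set mm := min_inf _ _ => mm_gt0; set c := ceil_div _ _.
have kc : k.+1 <= c * mm.
  exact: le_ceil_div_mul.
apply: (@leq_trans (size (iota 1 c.-1)).+1); last first.
  by rewrite size_iota prednK // lt0n; apply: contraTneq kc => ->.
rewrite ltnS cardE -(size_map (fun j : 'I_k.+1 => j %/ mm)); apply: uniq_leq_size.
  rewrite map_inj_in_uniq ?enum_uniq // => i j; rewrite !mem_enum !inE.
  move=> /andP[_ /divnK di] /andP[_ /divnK dj] e; apply: val_inj.
  by rewrite /= -di e dj.
move=> _ /mapP[j + ->]; rewrite mem_enum inE mem_iota => /andP[j_gt0 jd].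
rewrite divn_gt0 // (dvdn_leq j_gt0 jd) add1n prednK; last first.
  by rewrite lt0n; apply: contraTneq kc => ->.
by rewrite ltn_divLR //; apply: leq_trans kc; apply: ltn_ord.
Qed.

Lemma msets_on_top S A : #|S| = k.+1 -> 0 < min_inf k.+1 m ->
  (A \in msets_on S) = (A == mset_of (fun x => x \in S)).
Proof.
move=> cS m_gt0; apply/idP/eqP => [/in_msets_on[sA cA _]|->].
  have le1 x : (x \in S) <= A x by rewrite -sA inE; case: (A x).
  have [_ e] := leqif_sum (fun x (_ : true) => leqif_eq (le1 x)).
  apply/msetP => x; rewrite mset_ofE; apply/esym/eqP.
  have s1 : \sum_(y < n) (y \in S : nat) = k.+1.
    by rewrite -cS -sum1_card [RHS]big_mkcond; apply: eq_bigr => y _; case: (y \in S).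
  move: e; rewrite -/(card_mset A) cA s1 eqxx.
  by move/esym/forallP/(_ x).
apply: msets_onP.
- by apply/setP => x; rewrite inE mset_ofE lt0b.
- rewrite -cS -sum1_card /card_mset [RHS]big_mkcond; apply: eq_bigr => x _.
  by rewrite mset_ofE; case: (x \in S).
- by move=> x; rewrite mset_ofE; case: (x \in S).
Qed.

(** A second multiset arises by moving one copy from an element of multiplicity above 1 to another
    element below the cap. *)
Lemma card_msets_on_gt1 S : 1 < min_inf k.+1 m -> 1 < #|S| < k.+1 ->
  k.+1 < #|S| * min_inf k.+1 m -> 0 < #|` msets_on S| -> 1 < #|` msets_on S|.
Proof.
set mm := min_inf _ _ => mm_gt1 /andP[S_gt1 Sk] kS.
rewrite cardfs_gt0 => /fset0Pn[A AS]; have [sA cA hA] := in_msets_on AS.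
have suppE x : (x \in S) = (0 < A x) by rewrite -sA inE.
have cardS : card_mset A = \sum_(x in S) A x.
  rewrite /card_mset [RHS]big_mkcond; apply: eq_bigr => x _.
  by rewrite suppE; case: posnP.
have [x xS Ax] : exists2 x, x \in S & A x < mm.
  apply/exists_inP; apply: contraTT kS; rewrite negb_exists_in => /forall_inP h.
  rewrite -leqNgt -cA cardS -sum_nat_const; apply: leq_sum => x xS.
  by rewrite leqNgt h.
have [y yS Ay] : exists2 y, y \in S & 1 < A y.
  apply/exists_inP; apply: contraTT Sk; rewrite negb_exists_in => /forall_inP h.
  rewrite -leqNgt -cA cardS -sum1_card; apply: leq_sum => y yS.
  by rewrite leqNgt h.
have [u [v [uS vS uv [Au Av]]]] : exists u v, [/\ u \in S, v \in S, u != v & A u < mm /\ 1 < A v].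
  (* If one element plays both roles, any other element [z] of [S] can take one of them, according
     to whether it has reached the cap. *)
  have [xy|xy] := eqVneq x y; last by exists x, y.
  have [z zS zx] : exists2 z, z \in S & z != x.
    have : 0 < #|S :\ x| by have := cardsD1 x S; rewrite xS; lia.
    by rewrite card_gt0 => /set0Pn[z]; rewrite !inE => /andP[zx zS]; exists z.
  have [Az|Az] := ltnP (A z) mm; first by rewrite xy in zx; exists z, y.
  by exists x, z; rewrite eq_sym; split=> //; split=> //; exact: leq_trans mm_gt1 Az.
pose A' := mset_of (fun z => if z == u then (A u).+1 else if z == v then (A v).-1 else A z).
have A'S : A' \in msets_on S.
  apply: msets_onP.
  - apply/setP => z; rewrite inE mset_ofE suppE.
    have [->|zu] := eqVneq z u; first by rewrite -suppE uS.
    have [->|zv] := eqVneq z v => //; move: Av; clear; lia.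
  - rewrite -cA /card_mset (bigD1 u) // (bigD1 v) /=; last by rewrite eq_sym.
    rewrite [RHS](bigD1 u) // [in RHS](bigD1 v) /=; last by rewrite eq_sym.
    rewrite !mset_ofE eqxx eq_sym (negPf uv) eqxx.
    rewrite (eq_bigr (fun z => A z)); last first.
      by move=> z /andP[zu zv]; rewrite mset_ofE (negPf zu) (negPf zv).
    have ar a b c : 1 < b -> a.+1 + (b.-1 + c) = a + (b + c) by clear; lia.
    exact: ar.
  - move=> z; rewrite mset_ofE; case: eqP => _ //; case: eqP => _ //.
    by apply: leq_trans (leq_pred _) _.
have AA' : A != A'.
  apply/negP => /eqP e; have := congr1 (fun B : {mset 'I_n} => B u) e.
  by rewrite /= mset_ofE eqxx => /n_Sn.
have : ([fset A; A'] `<=` msets_on S)%fset by rewrite fsubUset !fsub1set AS.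
by move/fsubset_leq_card; rewrite cardfs2 AA'.
Qed.

End MultisetsOnSupport.

Lemma starts_of_card_top k m : 0 < m -> #|starts_of_card k m k.+1| = 1.
Proof.
move=> m_gt0; suff -> : starts_of_card k m k.+1 = [set setT] by rewrite cards1.
apply/setP => C; rewrite in_set in_set1.
have [->|CT] := eqVneq C setT.
  rewrite cardsT card_ord eqxx andbT; apply/block_startsP; split=> [|i im]; first by rewrite in_setT.
  have ik : i < k.+1 by move: im m_gt0; clear; lia.
  by exists (Ordinal ik); [rewrite in_setT | move: m_gt0 => /=; clear; lia].
apply/negP => /andP[_ /eqP cC]; case/negP: CT.
by rewrite eqEcard subsetT cardsT card_ord cC /=.
Qed.

Lemma starts_of_card_big k m t : k.+1 < t -> #|starts_of_card k m t| = 0.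
Proof.
move=> kt; apply/eqP; rewrite cards_eq0; apply/eqP/setP => C; rewrite in_set in_set0.
apply/negP => /andP[_ /eqP cC]; move: kt; rewrite -cC.
by rewrite ltnNge -[X in _ <= X](card_ord k.+1) max_card.
Qed.

(** List all ordinals as the point, then the set, then the rest; matching positions in the two lists
    gives the permutation. *)
Lemma perm_moving_pointed_set N (x y : 'I_N) (H G : {set 'I_N}) :
    x \notin H -> y \notin G -> #|H| = #|G| ->
  exists s : {perm 'I_N}, s x = y /\ s @: H = G.
Proof.
move=> xH yG HG.
pose L (z : 'I_N) (K : {set 'I_N}) := z :: enum K ++ enum (~: (z |: K)).
have uL z (K : {set 'I_N}) : z \notin K -> uniq (L z K).
  move=> zK; rewrite /= mem_cat !mem_enum (negPf zK) !inE eqxx /= cat_uniq !enum_uniq /= andbT.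
  by apply/hasPn => u; rewrite !mem_enum !inE negb_or => /andP[_].
have mL z (K : {set 'I_N}) u : u \in L z K.
  by rewrite inE mem_cat !mem_enum !inE negb_or; case: eqP => //= _; case: (u \in K).
have sL z (K : {set 'I_N}) : z \notin K -> size (L z K) = N.
  move=> zK; have := card_uniqP (uL z K zK) => <-.
  by rewrite -[RHS](card_ord N); apply: eq_card => u; rewrite mL.
pose f u := nth y (L y G) (index u (L x H)).
have idx u : index u (L x H) < size (L y G) by rewrite (sL _ _ yG) -[X in _ < X](sL x H xH) index_mem mL.
have f_inj : injective f.
  move=> u v /eqP; rewrite nth_uniq ?uL // => /eqP e.
  by rewrite -(nth_index x (mL x H u)) e nth_index.
exists (perm f_inj); split; first by rewrite permE /f /= eqxx.
apply/eqP; rewrite eqEcard card_imset ?HG ?leqnn ?andbT; last exact: perm_inj.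
apply/subsetP => _ /imsetP[u uH ->]; rewrite permE /f /=.
have -> : x == u = false by apply/negP => /eqP e; rewrite e uH in xH.
have iu : index u (enum H) < size (enum G) by rewrite -cardE -HG cardE index_mem mem_enum.
rewrite /= index_cat mem_enum uH nth_cat iu -mem_enum; exact: mem_nth.
Qed.

(** * Passing from families of multisets to families of supports *)

Section Supports.
Variables (n k : nat) (m : option nat).
Implicit Types (A B : {mset 'I_n}) (S : {set 'I_n}) (P : {set {set 'I_n}}).

Lemma msetI_neq0 A B : ((A `&` B)%mset != mset0) = (supp A :&: supp B != set0).
Proof.
congr (~~ _); apply/eqP/eqP => [AB|AB].
  apply/setP => x; rewrite !inE; have := congr1 (fun C : {mset 'I_n} => C x) AB.
  by rewrite /= msetE2 mset0E -leq_min => ->.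
apply/msetP => x; rewrite msetE2 mset0E; apply/eqP; rewrite -leqn0 leqNgt leq_min.
by have := in_set0 x; rewrite -AB !inE => ->.
Qed.

Lemma supp_perm_mset (s : {perm 'I_n}) A : supp (perm_mset s A) = s @: supp A.
Proof.
apply/setP => x; rewrite -[x](permKV s) inE perm_msetE mem_imset ?inE //.
exact: perm_inj.
Qed.

Lemma perm_msetK (s : {perm 'I_n}) : cancel (perm_mset s) (perm_mset s^-1%g).
Proof.
move=> A; apply/msetP => x.
by rewrite -{1}[x](permK s) perm_msetE perm_msetE.
Qed.

Lemma perm_mset_ksubsets (s : {perm 'I_n}) A :
  (perm_mset s A \in ksubsets m n k) = (A \in ksubsets m n k).
Proof.
rewrite !in_ksubsets; congr ((_ == _) && _).
  rewrite /card_mset (reindex_inj (@perm_inj _ s)); apply: eq_bigr => i _.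
  by rewrite perm_msetE.
apply/forallP/forallP => h i; first by have := h (s i); rewrite perm_msetE.
by rewrite -[i](permKV s) perm_msetE.
Qed.

Lemma supp_Hset : k <= n -> #|supp (Hset n k)| = k.
Proof.
move=> kn; have := cardsC (supp (Hset n k)); rewrite card_ord.
have -> : ~: supp (Hset n k) = [set j : 'I_n | j < n - k].
  by apply/setP => j; rewrite !inE HsetE lt0b -ltnNge.
by rewrite card_ord_ltn ?leq_subr //; move: kn; clear; lia.
Qed.

Definition msets_with_support P : {fset {mset 'I_n}} :=
  [fset A in ksubsets m n k | supp A \in P].

Lemma in_msets_with_support P A :
  (A \in msets_with_support P) = (A \in ksubsets m n k) && (supp A \in P).
Proof. by rewrite in_fset /= inE. Qed.

End Supports.

Lemma card_msets_with_support n k m (P : {set {set 'I_n}}) :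
    0 < min_inf k.+1 m ->
  #|` msets_with_support k.+1 m P| =
    \sum_(s < n.+1) #|layer P s| * #|starts_of_card k (min_inf k.+1 m) s|.
Proof.
move=> m_gt0; rewrite card_fset_sum1 (partition_big (@supp n) xpredT) //=.
have -> : \sum_(S : {set 'I_n}) \sum_(A <- msets_with_support k.+1 m P | supp A == S) 1
    = \sum_(S in P) #|starts_of_card k (min_inf k.+1 m) #|S| |.
  rewrite [RHS]big_mkcond; apply: eq_bigr => S _.
  rewrite big_fset_condE -card_fset_sum1.
  case: ifP => SP; last first.
    apply/eqP; rewrite cardfs_eq0; apply/eqP/fsetP => A; rewrite in_fset0 in_fset /= inE.
    rewrite in_msets_with_support; apply/negP => /andP[/andP[_ AP] /eqP e].
    by rewrite e SP in AP.
  rewrite -card_msets_on //; congr #|` _ |; apply/fsetP => A.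
  rewrite [LHS]in_fset [LHS]inE /= in_msets_with_support [RHS]in_fset [RHS]inE /=.
  by case: eqP => [->|]; rewrite ?andbF // SP andbT.
rewrite (partition_big (fun S : {set 'I_n} => inord #|S| : 'I_n.+1) xpredT) //=.
apply: eq_bigr => s _.
have cS (S : {set 'I_n}) : (inord #|S| == s) = (#|S| == s).
  by rewrite -val_eqE /= inordK // ltnS -[X in _ <= X](card_ord n) max_card.
rewrite (eq_bigl (fun S => S \in layer P s)); last by move=> S; rewrite cS inE.
rewrite (eq_bigr (fun=> #|starts_of_card k (min_inf k.+1 m) s|)) ?sum_nat_const //.
by move=> S; rewrite inE => /andP[_ /eqP ->].
Qed.

(** Apart from [Hset], membership depends on the support alone; and since [#|H| = k.+1], [Hset] is
    the only multiset of this cardinality with support [H]. *)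
Lemma HM_msets_with_support n k m (x0 : 'I_n) : val x0 = 0 -> k.+1 < n ->
    0 < min_inf k.+1 m ->
  HM m n k.+1 = msets_with_support k.+1 m (hm_family x0 (supp (Hset n k.+1)) k.+1).
Proof.
move=> x00 kn m_gt0; set H := supp _.
have cH : #|H| = k.+1 by apply: supp_Hset; apply: ltnW.
have HH : Hset n k.+1 \in msets_on k m H.
  apply: msets_onP => //.
    rewrite -[RHS]cH /card_mset -[RHS]sum1_card [RHS]big_mkcond; apply: eq_bigr => i _.
    by rewrite /H in_set HsetE; case: (n - k.+1 <= i).
  by move=> x; rewrite HsetE; case: (_ <= x).
apply/fsetP => A; rewrite in_msets_with_support /HM in_fsetU in_fset1 in_fset /= inE.
rewrite msetI_neq0 -/H /EKR in_fset /= inE.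
have -> : [exists i : 'I_n, (val i == 0) && (i \in (A : {mset 'I_n}))] = (x0 \in supp A).
  apply/existsP/idP => [[i /andP[/eqP i0]]|]; rewrite inE -in_mset; last first.
    by exists x0; rewrite x00 eqxx.
  by rewrite (_ : x0 = i) //; apply: val_inj; rewrite i0.
have [AK|AK] := boolP (A \in ksubsets m n k.+1); last first.
  rewrite /=; apply/negP => /eqP e; case/negP: AK; rewrite e.
  by move: HH; rewrite in_fset /= inE => /andP[].
rewrite /= /hm_family !inE -in_mset; congr (_ || _).
  rewrite (_ : #|supp A| <= k.+1) //.
  move: AK; rewrite in_ksubsets => /andP[/eqP <- _].
  rewrite /card_mset -sum1_card big_mkcond; apply: leq_sum => i _.
  by rewrite inE; case: ifP.
apply/eqP/eqP => [->//|sA].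
have AH : A \in msets_on k m H by rewrite in_fset /= inE AK sA eqxx.
by move: AH HH; rewrite !msets_on_top // => /eqP -> /eqP ->.
Qed.

Definition supports n (F : {fset {mset 'I_n}}) : {set {set 'I_n}} :=
  [set S | S \in [seq supp A | A <- F]].

Lemma supportsP n (F : {fset {mset 'I_n}}) S :
  reflect (exists2 A, A \in F & S = supp A) (S \in supports F).
Proof. by rewrite inE; apply: mapP. Qed.

Lemma supports_intersecting n (F : {fset {mset 'I_n}}) :
  intersecting F -> setfam_intersecting (supports F).
Proof.
move=> iF _ _ /supportsP[A AF ->] /supportsP[B BF ->].
by rewrite -msetI_neq0; apply: iF.
Qed.

Lemma supports_nontrivial n (F : {fset {mset 'I_n}}) :
  total_intersection_empty F -> setfam_nontrivial (supports F).
Proof.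
case=> A0 A0F F0 x.
have [/allP all_x|] := boolP (all (fun A : {mset 'I_n} => x \in supp A) F).
  have : 0 < (\big[@msetI _/A0]_(A <- F) A) x.
    rewrite big_seq; apply: (big_ind (fun B : {mset 'I_n} => 0 < B x)).
    - by have := all_x _ A0F; rewrite inE.
    - by move=> B C Bx Cx; rewrite msetE2 leq_min Bx.
    - by move=> A /all_x; rewrite inE.
  by rewrite F0 mset0E.
by move=> /allPn[A AF xA]; exists (supp A) => //; apply/supportsP; exists A.
Qed.

Lemma supports_card n k m (F : {fset {mset 'I_n}}) : (F `<=` ksubsets m n k)%fset ->
  forall S, S \in supports F -> #|S| <= k.
Proof.
move=> /fsubsetP FK _ /supportsP[A /FK + ->]; rewrite in_ksubsets => /andP[/eqP <- _].
rewrite /card_mset -sum1_card big_mkcond; apply: leq_sum => i _.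
by rewrite inE; case: ifP.
Qed.

Lemma ceil_div_lt k m : 2 < k -> le_inf 2 m -> ceil_div k m < k.
Proof.
case: m => [b|] k_gt2 /= m_ge2; last by move: k_gt2; clear; lia.
have b_gt0 : 0 < b by apply: ltnW.
rewrite -/(ceil_div k (Some b)) -[X in _ < X](prednK (ltnW (ltnW k_gt2))) ltnS.
by rewrite ceil_div_le //; move: k_gt2 m_ge2; clear; nia.
Qed.

Lemma ceil_div_gt1 k m : le_inf 1 m -> ~~ (min_inf k m %| k) -> 1 < ceil_div k m.
Proof.
case: m => [b|] b_gt0; last by rewrite /= dvdnn.
move=> nd; rewrite ltnNge ceil_div_le // mul1n; apply: contra nd => kb.
by rewrite /= (minn_idPl kb).
Qed.

(** * The bound and the case of equality *)

Section Main.
Variables (n k : nat) (m : option nat) (F : {fset {mset 'I_n}}).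
Hypotheses (k_ge4 : 4 <= k.+1) (m_ge2 : le_inf 2 m).
Hypotheses (n_ge : k.+1 + ceil_div k.+1 m <= n).
Hypotheses (F_sub : (F `<=` ksubsets m n k.+1)%fset).
Hypotheses (F_nti : nontrivial_intersecting F).

Let mm := min_inf k.+1 m.
Let w s := #|starts_of_card k mm s|.

Lemma min_inf_gt1 : 1 < mm.
Proof.
by rewrite /mm; case: (m) m_ge2 => [b|] /=; rewrite ?leq_min; move: k_ge4; clear; lia.
Qed.
Let mm_gt0 : 0 < mm := ltnW min_inf_gt1.

Lemma k_lt_n : k.+1 < n.
Proof.
apply: leq_trans n_ge; rewrite -addn1 leq_add2l.
by apply: leq_trans (card_multiples mm_gt0).
Qed.

Lemma weight_mono s t : s <= t <= k.+1 -> s + t = #|'I_n| -> w t <= w s.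
Proof.
move=> /andP[st tk] e; apply: starts_of_card_mono => //.
by rewrite e card_ord; apply: leq_trans n_ge; rewrite leq_add2l card_multiples.
Qed.

Lemma card_family_le : #|` F| <= #|` msets_with_support k.+1 m (supports F)|.
Proof.
apply: fsubset_leq_card; apply/fsubsetP => A AF; rewrite in_msets_with_support.
by rewrite (fsubsetP F_sub) //; apply/supportsP; exists A.
Qed.

Let iS := supports_intersecting F_nti.1.
Let ntS := supports_nontrivial F_nti.2.
Let kS := supports_card F_sub.
Let H := supp (Hset n k.+1).

Lemma origin_notin_H (x0 : 'I_n) : val x0 = 0 -> x0 \notin H.
Proof. by move=> x00; rewrite inE HsetE x00 lt0b leqNgt subn_gt0 k_lt_n. Qed.

Lemma nontrivial_le_HM : #|` F| <= #|` HM m n k.+1|.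
Proof.
have n_gt0 : 0 < n by apply: leq_trans k_lt_n.
pose x0 := Ordinal n_gt0; apply: leq_trans card_family_le _.
rewrite (@HM_msets_with_support _ _ _ x0) ?k_lt_n // !card_msets_with_support //.
have := @weighted_sum_le _ _ k.+1 x0 H iS ntS kS _ _ w _ weight_mono.
rewrite card_ord; apply; first exact: origin_notin_H.
  by apply: supp_Hset; apply/ltnW/k_lt_n.
by move=> t; apply: starts_of_card_big.
Qed.

Hypothesis AB : k.+1 + ceil_div k.+1 m < n \/
   n = k.+1 + ceil_div k.+1 m /\ ~~ (min_inf k.+1 m %| k.+1).

Lemma max_supports_HM : #|` F| = #|` HM m n k.+1| ->
  exists x, exists2 G : {set 'I_n}, (x \notin G) && (#|G| == k.+1) &
    supports F \subset hm_family x G k.+1.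
Proof.
move=> eF; have n_gt0 : 0 < n by apply: leq_trans k_lt_n.
(* [s >= 2] is required by [tight_layer_hm_family], and [s >= q] makes [w s] positive. *)
pose x0 := Ordinal n_gt0; pose q := ceil_div k.+1 m; pose s := maxn 2 q.
have q_lt : q < k.+1 by apply: ceil_div_lt => //; apply: ltnW.
have q_gt0 : 0 < q by apply: leq_trans (card_multiples mm_gt0).
have s_gt1 : 1 < s by rewrite leq_maxl.
have qs : q <= s by rewrite leq_maxr.
have sk : s < k.+1 by rewrite gtn_max q_lt andbT; apply: leq_trans k_ge4.
(* Under (A) use [maxn 2 q <= q.+1]; under (B) non-divisibility gives [1 < q], so [s = q]. *)
have sn : s + k.+1 <= n.
  rewrite addnC /s; case: AB => [|[-> nd]].
    by move: q_gt0; rewrite -/q; clear; lia.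
  rewrite (maxn_idPr _) //; apply: ceil_div_gt1 nd.
  by case: (m) m_ge2 => // b; apply: ltnW.
have st : s + (n - s) = #|'I_n| by rewrite card_ord; move: sn; clear; lia.
have kt : k.+1 <= n - s by move: sn; clear; lia.
have wk : w k.+1 = 1 by apply: starts_of_card_top.
have ws : 0 < w s.
  rewrite -wk; apply: starts_of_card_mono => //; first exact: ltnW.
  by rewrite addnC leq_add2r; apply: leq_trans (card_multiples mm_gt0) _.
have x0H := @origin_notin_H x0 erefl.
have cH : #|H| = k.+1 by apply: supp_Hset; apply/ltnW/k_lt_n.
have sums : \sum_(u < #|'I_n|.+1) #|layer (hm_family x0 H k.+1) u| * w u
    <= \sum_(u < #|'I_n|.+1) #|layer (supports F) u| * w u.
  rewrite card_ord -!card_msets_with_support // -HM_msets_with_support ?k_lt_n //.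
  by rewrite -eF card_family_le.
have hf : #|layer (hm_family x0 H k.+1) s| <= #|layer (supports F) s|.
  apply: (@weighted_layer_tight _ _ k.+1 x0 H iS ntS kS x0H cH w _ weight_mono s (n - s) st _ _ sums).
  - by move=> t; apply: starts_of_card_big.
  - by apply: leq_trans sk kt.
  - case: ifP => // /negbT; rewrite -leqNgt => tk.
    (* Here the complementary layer has weight 1, so two multisets on one support of size [s]
       suffice. *)
    have -> : n - s = k.+1 by apply/eqP; rewrite eqn_leq tk kt.
    have [S cS] : exists S : {set 'I_n}, #|S| = s.
      have [|S _ cS] := @superset_of_size _ set0 [set: 'I_n] s (sub0set _).
        by rewrite cards0 cardsT card_ord; move: sn; clear; lia.
      by exists S.
    rewrite wk -cS /w -card_msets_on //; apply: card_msets_on_gt1; rewrite ?cS ?s_gt1 ?min_inf_gt1 //.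
      (* The goal is [k.+1 < s * mm], knowing [k.+1 <= q * mm]. Under (A) now [q < s]; under (B)
         equality would make [mm] divide [k.+1]. *)
      have kq := le_ceil_div_mul mm_gt0; rewrite -/q -/mm in kq.
      case: AB => [nq|[nq nd]].
        have qs' : q < s by move: nq tk; rewrite -/q; clear; lia.
        by apply: leq_ltn_trans kq _; rewrite ltn_pmul2r.
      rewrite ltn_neqAle (leq_trans kq) ?leq_pmul2r // andbT.
      by apply: contraNneq nd => e; rewrite [X in _ %| X]e dvdn_mull.
    by rewrite card_msets_on // cS.
apply: (@tight_layer_hm_family _ (supports F) k.+1 s) => //.
- by rewrite s_gt1.
- by rewrite card_ord.
have := @hm_layer_ge _ x0 H k.+1 s.-1 x0H cH.
rewrite prednK ?(ltnW s_gt1) // -subn1 => /(_ (ltnW sk)) hl.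
apply: leq_trans (leq_add hf (leqnn _)); apply: leq_trans hl.
exact: leq_addr.
Qed.

(** A permutation taking the origin to [x] and [H] to [G] puts [F] inside the image of the
    HM-family; equal cardinalities make this an equality. *)
Lemma max_family_isomorphic_HM : #|` F| = #|` HM m n k.+1| -> isomorphic F (HM m n k.+1).
Proof.
move=> eF; have n_gt0 : 0 < n by apply: leq_trans k_lt_n.
pose x0 := Ordinal n_gt0.
have [x [G /andP[xG /eqP cG] /subsetP subG]] := max_supports_HM eF.
have cH : #|H| = k.+1 by apply: supp_Hset; apply/ltnW/k_lt_n.
have [|s [sx sH]] := perm_moving_pointed_set (@origin_notin_H x0 erefl) xG.
  by rewrite cG -cH.
exists s; apply/eqP; rewrite eqEfcard; apply/andP; split; last first.
  by rewrite eF card_imfset //=; apply: can_inj (perm_msetK s).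
apply/fsubsetP => A AF; apply/imfsetP; exists (perm_mset s^-1%g A) => /=; last first.
  by have := perm_msetK s^-1%g A; rewrite invgK => ->.
rewrite (@HM_msets_with_support _ _ _ x0) ?k_lt_n // in_msets_with_support.
rewrite perm_mset_ksubsets (fsubsetP F_sub) //= supp_perm_mset.
have sinv (S : {set 'I_n}) y : (y \in s^-1%g @: S) = (s y \in S).
  by rewrite -{1}[y](permK s) mem_imset //; apply: perm_inj.
have : supp A \in hm_family x G k.+1 by apply: subG; apply/supportsP; exists A.
rewrite !in_hm_family => /orP[/and3P[cA xA GA]|/eqP ->]; apply/orP; last first.
  by right; apply/eqP/setP => y; rewrite sinv -sH mem_imset //; apply: perm_inj.
left; rewrite card_imset; last exact: perm_inj.
rewrite cA sinv sx xA /=.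
have /set0Pn[y] := GA; rewrite in_setI -sH => /andP[yA /imsetP[z zH ey]].
by apply/set0Pn; exists z; rewrite in_setI sinv -ey yA.
Qed.

End Main.

Lemma isomorphic_card n (F' F : {fset {mset 'I_n}}) : isomorphic F' F -> #|` F'| = #|` F|.
Proof. by case=> s ->; rewrite card_imfset //=; apply: can_inj (perm_msetK s). Qed.

Theorem theorem1p5 (n k : nat) (m : option nat) (F : {fset {mset 'I_n}})
    (k_ge4 : 4 <= k) (m_ge2 : le_inf 2 m) (n_ge : k + ceil_div k m <= n)
    (F_sub : (F `<=` ksubsets m n k)%fset)
    (F_nti : nontrivial_intersecting F) :
  #|` F| <= #|` HM m n k| /\
  (k + ceil_div k m < n \/
   n = k + ceil_div k m /\ ~~ (min_inf k m %| k) ->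
   (#|` F| = #|` HM m n k| <-> isomorphic F (HM m n k))).
Proof.
case: k k_ge4 n_ge F_sub => // k k_ge4 n_ge F_sub; split.
  exact: nontrivial_le_HM.
move=> AB; split; last exact: isomorphic_card.
exact: max_family_isomorphic_HM.
Qed.
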